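(* Assume that $k_1>0$ and $k_2>0$ (real numbers). For $x,y\in\mathbb{R}$ with $|x|>|y|$ let $$\mathcal{K}(x,y)=\frac{c}{4}\,A(x)^{-1}\int_{|y|}^{|x|}\sigma(x,y,z)\,\Bigl(\cosh\frac z2-\cosh\frac y2\Bigr)^{k_1-1}\,(\cosh x-\cosh z)^{k_2-1}\,\Bigl(\sinh\frac z2\Bigr)\,dz,$$ where $$c=2^{3k_1+3k_2}\,\frac{\Gamma(k_1+k_2+\frac12)}{\sqrt{\pi}\,\Gamma(k_1)\,\Gamma(k_2)},\qquad \sigma(x,y,z)=(\operatorname{sign}x)\,\Bigl\{e^{\frac x2}\Bigl(2\cosh\frac x2\Bigr)-e^{-\frac y2}\Bigl(2\cosh\frac z2\Bigr)\Bigr\}.$$ Then $\mathcal{K}(x,y)>0$ for every $x,y\in\mathbb{R}$ such that $|x|>|y|$. Hence the intertwining operator $\mathcal{V}$ and its dual $\mathcal{V}^t$ (with parameters $k_1,k_2$) are positive, that is, $\mathcal{V}f\ge0$ for every $f\in C^\infty(\mathbb{R})$ with $f\ge0$, and $\mathcal{V}^tg\ge0$ for every $g\in C_c^\infty(\mathbb{R})$ with $g\ge0$.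
   Context: For parameters $k_1,k_2$, the Cherednik operator on $C^\infty(\mathbb{R})$ (complex-valued functions) is $$Df(x)=f'(x)+\Bigl\{\frac{k_1}{1-e^{-x}}+\frac{2k_2}{1-e^{-2x}}\Bigr\}\{f(x)-f(-x)\}-\Bigl(\frac{k_1}2+k_2\Bigr)f(x),$$ extended to $x=0$ by continuity. The weight is $$A(x)=\bigl|2\sinh\tfrac x2\bigr|^{2k_1}\,\bigl|2\sinh x\bigr|^{2k_2}.$$ The intertwining operator is the continuous linear operator $\mathcal{V}:C^\infty(\mathbb{R})\to C^\infty(\mathbb{R})$ (with $C^\infty(\mathbb{R})$ carrying its usual Fréchet topology) characterized by $$\mathcal{V}\circ\frac{d}{dx}=D\circ\mathcal{V}\quad\text{and}\quad \mathcal{V}f(0)=f(0)\ \text{ for all } f\in C^\infty(\mathbb{R}).$$ For every $\lambda\in\mathbb{C}$, it maps $x\mapsto e^{i\lambda x}$ to the Opdam hypergeometric function $$G_{i\lambda}(x)={}_2F_1\bigl(\tfrac{k_1}2+k_2+i\lambda,\tfrac{k_1}2+k_2-i\lambda;k_1+k_2+\tfrac12;-\sinh^2\tfrac x2\bigr)+\frac{\frac{k_1}2+k_2+i\lambda}{2k_1+2k_2+1}(\sinh x)\,{}_2F_1\bigl(\tfrac{k_1}2+k_2+1+i\lambda,\tfrac{k_1}2+k_2+1-i\lambda;k_1+k_2+\tfrac32;-\sinh^2\tfrac x2\bigr).$$ The dual operator $\mathcal{V}^t:C_c^\infty(\mathbb{R})\to C_c^\infty(\mathbb{R})$ is determined by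 $$\int_{-\infty}^{+\infty}\mathcal{V}f(x)\,g(x)\,A(x)\,dx=\int_{-\infty}^{+\infty}f(y)\,\mathcal{V}^t g(y)\,dy\qquad\text{for all } f\in C^\infty(\mathbb{R}),\ g\in C_c^\infty(\mathbb{R}).$$ The function $\mathcal{K}$ in the claim is the integral kernel of these operators: $\mathcal{V}f(x)=\int_{|y|<|x|}\mathcal{K}(x,y)f(y)\,dy$ for $x\neq0$, and $\mathcal{V}^tg(y)=\int_{|x|>|y|}\mathcal{K}(x,y)g(x)A(x)\,dx$. *)

(* Defs.v *)
From HB Require Import structures.
From mathcomp Require Import all_boot all_order all_algebra.
From mathcomp Require Import all_classical all_reals all_analysis.
From mathcomp.real_closed Require Export complex.

Set Implicit Arguments.
Unset Strict Implicit.
Unset Printing Implicit Defensive.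

Import Order.TTheory GRing.Theory Num.Theory.
Import numFieldNormedType.Exports.

Local Open Scope classical_set_scope.
Local Open Scope ring_scope.
Local Open Scope complex_scope.

(* MathComp-Analysis has no normed R-module structure on R[i] and no integral
   of complex-valued functions, so limits, derivatives and integrals of
   functions R -> R[i] are taken on real and imaginary parts. *)
Section ComplexValued.
Context {R : realType}.
Implicit Types f g : R -> R[i].

Definition Ref f : R -> R := fun x => complex.Re (f x).
Definition Imf f : R -> R := fun x => complex.Im (f x).

Definition clim_at f (a : R) : R[i] :=
  lim (Ref f x @[x --> a^']) +i* lim (Imf f x @[x --> a^']).

Definition cderive f : R -> R[i] :=
  fun x => (Ref f)^`()%classic x +i* (Imf f)^`()%classic x.

Definition cderiven (n : nat) f : R -> R[i] := iter n cderive f.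

Definition cintegral f : R[i] :=
  (\int[lebesgue_measure]_x Ref f x) +i* (\int[lebesgue_measure]_x Imf f x).

(* C^oo(R) *)
Definition smooth f : Prop :=
  forall (n : nat) (x : R), derivable ((Ref f)^`(n)%classic) x 1 /\
                            derivable ((Imf f)^`(n)%classic) x 1.

(* C_c^oo(R) *)
Definition test_function f : Prop :=
  smooth f /\ compact (closure [set x | f x != 0]).

(* Basic neighbourhoods of f in the Frechet topology of C^oo(R), i.e. balls of
   the increasing family of seminorms
   h |-> max_(k <= n) sup_(|x| <= n) |h^(k)(x)|. *)
Definition smooth_ball (n : nat) f (e : R) : set (R -> R[i]) :=
  [set g | smooth g /\
    forall (k : nat) (x : R), (k <= n)%N -> `|x| <= n%:R ->
      `|cderiven k g x - cderiven k f x| < e%:C].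

(* Operators on C^oo(R) are total maps on functions, of which only the values
   at smooth functions matter. *)
Implicit Types V W : (R -> R[i]) -> (R -> R[i]).

Definition smooth_operator V : Prop := forall f, smooth f -> smooth (V f).

Definition linear_operator V : Prop :=
  forall (a : R[i]) f g, smooth f -> smooth g ->
    forall x, V (fun t => a * f t + g t) x = a * V f x + V g x.

Definition continuous_operator V : Prop :=
  forall f, smooth f -> forall (n : nat) (e : R), 0 < e ->
    exists (m : nat) (d : R), 0 < d /\
      forall g, smooth_ball m f d g -> smooth_ball n (V f) e (V g).

End ComplexValued.

Section Cherednik.
Context {R : realType}.
Implicit Types (x y z s : R) (f g : R -> R[i]).

Definition sinh x : R := (expR x - expR (- x)) / 2.
Definition cosh x : R := (expR x + expR (- x)) / 2.

Definition Gamma s : R :=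
  \int[lebesgue_measure]_(t in `]0, +oo[) (t `^ (s - 1) * expR (- t)).

Variables k1 k2 : R.

Definition weight x : R :=
  `|2 * sinh (x / 2)| `^ (2 * k1) * `|2 * sinh x| `^ (2 * k2).

(* the formula for the Cherednik operator, meaningful only for x != 0 *)
Definition cherednik_formula f x : R[i] :=
  cderive f x
  + (k1 / (1 - expR (- x)) + 2 * k2 / (1 - expR (- (2 * x))))%:C
    * (f x - f (- x))
  - (k1 / 2 + k2)%:C * f x.

Definition cherednik f x : R[i] :=
  if x == 0 then clim_at (cherednik_formula f) 0 else cherednik_formula f x.

Record intertwining_operator (V : (R -> R[i]) -> (R -> R[i])) : Prop := {
  intertwining_smooth : smooth_operator V;
  intertwining_linear : linear_operator V;
  intertwining_continuous : continuous_operator V;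
  intertwining_derive : forall f, smooth f ->
    forall x, V (cderive f) x = cherednik (V f) x;
  intertwining_at0 : forall f, smooth f -> V f 0 = f 0 }.

Record dual_operator (V Vt : (R -> R[i]) -> (R -> R[i])) : Prop := {
  dual_test : forall g, test_function g -> test_function (Vt g);
  dual_integral : forall f g, smooth f -> test_function g ->
    cintegral (fun x => V f x * g x * (weight x)%:C) =
    cintegral (fun y => f y * Vt g y) }.

Definition kernel_const : R :=
  2 `^ (3 * k1 + 3 * k2) * Gamma (k1 + k2 + 1 / 2)
  / (Num.sqrt pi * Gamma k1 * Gamma k2).

Definition kernel_sigma x y z : R :=
  Num.sg x * (expR (x / 2) * (2 * cosh (x / 2))
              - expR (- (y / 2)) * (2 * cosh (z / 2))).

Definition kernelK x y : R :=
  kernel_const / 4 * (weight x)^-1 *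
  \int[lebesgue_measure]_(z in `](`|y|), (`|x|)[)
    (kernel_sigma x y z
     * (cosh (z / 2) - cosh (y / 2)) `^ (k1 - 1)
     * (cosh x - cosh z) `^ (k2 - 1)
     * sinh (z / 2)).

End Cherednik.

(* Main.v *)
Require Import Defs.
From mathcomp Require Import all_boot all_order all_algebra.
From mathcomp Require Import all_classical all_reals all_analysis.
From mathcomp.real_closed Require Import complex.
From mathcomp Require Import measurable_realfun ring lra.

(** Positivity of the intertwining operator is obtained without its integral
    kernel. For fixed [f] put [u(x, a) = Re (V (f (. + a)) x)]. Since [V] is
    continuous and [V (f') = D (V f)], along each line [a = b - x] the function
    [w(x) = u(x, b - x)] satisfies
    [w'(x) = - q(x) (w(x) - u(- x, b - x)) + rho w(x)], where [q] is the
    coefficient of [f(x) - f(- x)] in [D] and [rho = k1 / 2 + k2]. As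
    [x q(x) >= 0], this transport system with reflection is cooperative away
    from [x = 0] and has the data [u(0, a) = Re (f a)], so that a maximum
    principle gives [u > 0] whenever [Re f > 0]; the general case follows by
    adding a small positive constant to [f].

    The dual operator is positive because a smooth compactly supported [r] with
    [\int p r >= 0] for all smooth [p >= 0] is nonnegative.

    For the kernel, [sigma > 0] as [e^(x/2) 2 cosh (x/2) = e^x + 1], and the
    integrand is dominated by the derivative of a bounded function, which makes
    its integral finite as well as positive. *)

Set Implicit Arguments.
Unset Strict Implicit.
Unset Printing Implicit Defensive.

Import Order.TTheory GRing.Theory Num.Theory.
Import numFieldNormedType.Exports.
Local Open Scope classical_set_scope.
Local Open Scope ring_scope.
Local Open Scope complex_scope.

(** * A maximum principle for transport with reflection *)

Lemma is_derive_fct (R : realType) (f : R -> R) (x l l' : R) :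
  l = l' -> is_derive x 1 f l -> is_derive x 1 f l'.
Proof. by move=> ->. Qed.

Lemma is_derive_fctD (R : realType) (f g : R -> R) (x a b : R) :
  is_derive x 1 f a -> is_derive x 1 g b ->
  is_derive x 1 (fun t => f t + g t) (a + b).
Proof. by move=> ? ?; exact: is_deriveD. Qed.

Lemma is_derive_fctM (R : realType) (f g : R -> R) (x a b : R) :
  is_derive x 1 f a -> is_derive x 1 g b ->
  is_derive x 1 (fun t => f t * g t) (a * g x + f x * b).
Proof.
move=> ? ?; have := is_deriveM (f := f) (g := g) (x := x) (v := 1).
by rewrite addrC [a * _]mulrC; apply.
Qed.

Lemma is_derive_fctZ (R : realType) (f : R -> R) (c x a : R) :
  is_derive x 1 f a -> is_derive x 1 (fun t => c * f t) (c * a).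
Proof.
move=> df; have := is_derive_fctM (is_derive_cst c x 1) df.
by rewrite mul0r add0r.
Qed.

Lemma is_derive_fctN (R : realType) (f : R -> R) (x a : R) :
  is_derive x 1 f a -> is_derive x 1 (fun t => - f t) (- a).
Proof. by move=> ?; exact: is_deriveN. Qed.

Lemma derivable1_continuous (R : realType) (f : R -> R) (x : R) :
  derivable f x 1 -> {for x, continuous f}.
Proof. by move=> /derivable1_diffP /differentiable_continuous. Qed.

(** The derivative of [expR (M * x) * w x] is [expR (M * x) * (dw x + M * w x)], which is
    nonnegative, so this product does not decrease from [a] to [b]. *)
Lemma gronwall_gt0 (R : realType) (w dw : R -> R) (a b M : R) :
  a <= b ->
  (forall x, x \in `[a, b] -> is_derive x 1 w (dw x)) ->
  (forall x, x \in `]a, b[ -> 0 <= dw x + M * w x) ->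
  0 < w a -> 0 < w b.
Proof.
move=> ab dwE dwM wa.
pose E x := expR (M * x) * w x.
have dE (x : R) : x \in `[a, b] ->
    is_derive x 1 E (expR (M * x) * (dw x + M * w x)).
  move=> /dwE dwx; have dM := is_derive_fctZ M (is_derive_id x 1).
  have dexp := is_derive1_comp (is_derive_expR (M * x)) dM.
  by apply: is_derive_fct (is_derive_fctM dexp dwx); rewrite /=; ring.
have : E a <= E b.
  apply: (@ger0_derive1_le_cc _ E a b) => //; rewrite ?in_itv/= ?lexx ?ab//.
  - by move=> x /subset_itv_oo_cc /dE -[].
  - move=> x xab; have [_ dEx] := dE _ (subset_itv_oo_cc xab).
    by rewrite derive1E dEx mulr_ge0 ?expR_ge0 ?dwM.
  - by apply: derivable_within_continuous => x /dE [].
have Ea : 0 < E a by rewrite mulr_gt0 ?expR_gt0.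
by move=> /(lt_le_trans Ea); rewrite pmulr_rgt0 ?expR_gt0.
Qed.

(** Positivity on the part [|x| < x0] of the cone [|x| + |a| <= x0 + |a0|] is carried to [(x0, a0)]
    along the line [a = b - x] through that point. The reflected point [(- x, b - x)] has the same
    absolute values, hence lies in the same part of the cone. *)
Lemma reflection_transport_step (R : realType) (u : R -> R -> R) (q : R -> R)
    (rho x0 a0 : R) :
  (forall x : R, 0 <= x * q x) ->
  (forall r : R, 0 < r -> exists M, forall x : R, r <= `|x| -> `|q x| <= M) ->
  (forall x b : R, x != 0 -> is_derive x 1 (fun t => u t (b - t))
     (- q x * (u x (b - x) - u (- x) (b - x)) + rho * u x (b - x))) ->
  0 < x0 ->
  (forall x a, `|x| < x0 -> `|x| + `|a| <= x0 + `|a0| -> 0 < u x a) ->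
  0 < u x0 a0.
Proof.
move=> q0 qM du x00 upos.
have h0 : 0 < x0 / 2 by lra.
have [M MP] := qM _ h0.
pose b := x0 + a0.
pose w t := u t (b - t).
suff : 0 < w x0 by rewrite /w /b (_ : x0 + a0 - x0 = a0) //; ring.
(* Since [b - x = (x0 - x) + a0], the line stays in the cone for [0 < x < x0]. *)
have bx (x : R) : 0 < x -> x < x0 -> `|x| + `|b - x| <= x0 + `|a0|.
  move=> xp xx0; rewrite (_ : b - x = (x0 - x) + a0); last by rewrite /b; ring.
  have := ler_normD (x0 - x) a0.
  by rewrite (gtr0_norm xp) (@gtr0_norm _ (x0 - x)) ?subr_gt0//; lra.
(* The comparison starts at [x0 / 2], as [q] is only known to be bounded away from 0; there [M]
   bounds it. *)
apply: (@gronwall_gt0 _ w (fun x => - q x * (u x (b - x) - u (- x) (b - x))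
   + rho * u x (b - x)) (x0 / 2) x0 (M + `|rho|)).
- lra.
- move=> x; rewrite in_itv/= => /andP[x1 _]; apply: du.
  by rewrite gt_eqF//; lra.
- move=> x; rewrite in_itv/= => /andP[x1 x2].
  have xp : 0 < x by lra.
  have xn : `|x| = x by rewrite gtr0_norm.
  have w1 : 0 < u x (b - x) by apply: upos; rewrite ?xn ?bx// -{1}xn bx.
  have w2 : 0 < u (- x) (b - x) by apply: upos; rewrite normrN ?xn// -{1}xn bx.
  have qx : 0 <= q x by have := q0 x; rewrite pmulr_rge0.
  have := MP x; rewrite xn (ger0_norm qx) => /(_ (ltW x1)) qxM.
  have [r1 r2] : - `|rho| <= rho /\ 0 <= `|rho|.
    by split => //; rewrite lerNl -normrN ler_norm.
  rewrite /w.
  (* Cooperativity: in this grouping the positive values of [u] all have nonnegative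
     coefficients. *)
  rewrite (_ : _ + _ = (M - q x) * u x (b - x) + q x * u (- x) (b - x)
    + (rho + `|rho|) * u x (b - x)); last by ring.
  have r3 : 0 <= rho + `|rho| by lra.
  rewrite !addr_ge0//; apply: mulr_ge0 => //; try exact: ltW.
  by rewrite subr_ge0.
- apply: upos; first by rewrite gtr0_norm; lra.
  by apply: bx; lra.
Qed.

(** If [u <= 0] at some point, then among the points with [u <= 0] in the cone that it spans there
    is one, [(x0, a0)], of least [|x|]. All points of the cone with smaller [|x|] then have [u > 0],
    and [reflection_transport_step] forces [u (x0, a0) > 0], a contradiction. *)
Lemma reflection_transport_gt0 (R : realType) (u : R * R -> R) (q : R -> R)
    (rho : R) :
  continuous u ->
  (forall x : R, 0 <= x * q x) ->
  (forall r : R, 0 < r -> exists M, forall x : R, r <= `|x| -> `|q x| <= M) ->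
  (forall x b : R, x != 0 -> is_derive x 1 (fun t => u (t, b - t))
     (- q x * (u (x, b - x) - u (- x, b - x)) + rho * u (x, b - x))) ->
  (forall a, 0 < u (0, a)) ->
  forall x a, 0 < u (x, a).
Proof.
move=> cu q0 qM du u0 x1 a1; rewrite ltNge; apply/negP => u1.
pose C := `|x1| + `|a1|.
pose f1 (p : R * R) : R := `|p.1| + `|p.2|.
(* The square gives compactness, the other two factors are closed conditions. *)
pose K := (`[- C, C] `*` `[- C, C]) `&` (f1 @^-1` [set r | r <= C]
  `&` (u @^-1` [set r | r <= 0])) : set (R * R).
have cn1 : continuous (fun p : R * R => `|p.1|).
  move=> p; apply: continuous_comp; last exact: norm_continuous.
  exact: cvg_fst.
have cn2 : continuous (fun p : R * R => `|p.2|).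
  move=> p; apply: continuous_comp; last exact: norm_continuous.
  exact: cvg_snd.
have cf1 : continuous f1 by move=> p; apply: cvgD; [exact: cn1|exact: cn2].
have cK : compact K.
  apply: compact_closedI; first by apply: compact_setX; exact: segment_compact.
  apply: closedI; apply: preimage_closed => //; exact: closed_le.
have K0 : K !=set0.
  exists (x1, a1); split; last by split => //=; rewrite /f1.
  by split => /=; rewrite in_itv/= -ler_norml /C ?lerDl ?lerDr.
have [] := @compact_EVT_min _ _ (fun p : R * R => `|p.1|) K K0 cK.
  exact: continuous_subspaceT.
move=> [x0 a0]; rewrite inE => -[_ [/= C0 uneg]] minx0.
have upos x a : `|x| < `|x0| -> `|x| + `|a| <= `|x0| + `|a0| -> 0 < u (x, a).
  move=> xx0 xa; rewrite ltNge; apply/negP => uxa.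
  have xaC : `|x| + `|a| <= C by exact: le_trans C0.
  have /minx0 /= : (x, a) \in K.
    rewrite inE; split; last by [].
    split => /=; rewrite in_itv/= -ler_norml; apply: le_trans xaC.
      by rewrite lerDl.
    by rewrite lerDr.
  by rewrite leNgt xx0.
suff : 0 < u (x0, a0) by rewrite ltNge uneg.
have [x0n|x0p|->] := ltgtP x0 0; last exact: u0.
(* The symmetry [(x, a) -> (- x, - a)] reduces to [x0 > 0]: it replaces [q] by [- q (- x)], which
   has the same sign property, and [rho] by [- rho]. *)
- pose v x a := u (- x, - a).
  have -> : u (x0, a0) = v (- x0) (- a0) by rewrite /v !opprK.
  apply: (@reflection_transport_step _ v (fun x => - q (- x)) (- rho)).
  + by move=> x; have := q0 (- x); rewrite mulrN mulNr.
  + move=> r /qM [M MP]; exists M => x; rewrite normrN -(normrN x).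
    exact: MP.
  + move=> x b x_neq0.
    have hd := du (- x) (- b); rewrite oppr_eq0 in hd.
    have {hd} := is_derive1_comp (f := fun t => u (t, - b - t))
       (g := fun t => - t) (hd x_neq0) (is_derive_fctN (is_derive_id x 1)).
    rewrite /comp /v => hd.
    have -> : (fun t => u (- t, - (b - t))) = (fun t => u (- t, - b - - t)).
      by apply/funext => t; rewrite opprB addrC opprK.
    apply: is_derive_fct hd.
    by rewrite !opprK (_ : - (b - x) = - b + x); ring.
  + by rewrite oppr_gt0.
  + move=> x a; rewrite /v normrN -(ltr0_norm x0n) => h1 h2.
    by apply: upos; rewrite !normrN.
- apply: (@reflection_transport_step _ (fun x a => u (x, a)) q rho) => //.
  by move=> x a h1 h2; apply: upos; rewrite (gtr0_norm x0p).
Qed.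

(** * Smooth functions *)

(** The real-valued counterpart of [smooth]; [smoothE] reduces a complex function to its real and
    imaginary parts. *)
Record rsmooth (R : realType) (r : R -> R) : Prop := RSmooth {
  rsmooth_derivable : forall n x, derivable (derive1n n r) x 1 }.

Lemma rsmooth_derive1 (R : realType) (r : R -> R) :
  rsmooth r -> rsmooth r^`()%classic.
Proof.
by move=> sr; split=> n x; rewrite -derive1Sn; exact: rsmooth_derivable.
Qed.

Lemma rsmooth_is_derive (R : realType) (r : R -> R) (n : nat) (x : R) :
  rsmooth r -> is_derive x 1 (derive1n n r) (derive1n n.+1 r x).
Proof. move=> sr; apply: DeriveDef; first exact: rsmooth_derivable.
by rewrite derive1nS derive1E. Qed.

Lemma rsmooth_continuous (R : realType) (r : R -> R) (n : nat) :
  rsmooth r -> continuous (derive1n n r).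
Proof. by move=> sr x; exact/derivable1_continuous/rsmooth_derivable. Qed.

Lemma derive1n_lin (R : realType) (f g : R -> R) (c d : R) (n : nat) :
  rsmooth f -> rsmooth g ->
  derive1n n (fun t => c * f t + d * g t) =
  (fun t => c * derive1n n f t + d * derive1n n g t).
Proof.
move=> sf sg; elim: n => // n IHn; apply/funext => x.
rewrite derive1nS IHn derive1E.
have := is_derive_fctD (is_derive_fctZ c (rsmooth_is_derive n x sf))
  (is_derive_fctZ d (rsmooth_is_derive n x sg)).
by case.
Qed.

Lemma rsmooth_lin (R : realType) (f g : R -> R) (c d : R) :
  rsmooth f -> rsmooth g -> rsmooth (fun t => c * f t + d * g t).
Proof.
move=> sf sg; split=> n x; rewrite derive1n_lin//.
by have [] := is_derive_fctD (is_derive_fctZ c (rsmooth_is_derive n x sf))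
  (is_derive_fctZ d (rsmooth_is_derive n x sg)).
Qed.

Lemma derive1n_cst (R : realType) (c : R) (n : nat) :
  derive1n n.+1 (fun=> c) = (fun=> 0 : R).
Proof.
elim: n => [|n IHn]; last rewrite derive1nS IHn; apply/funext => x.
  exact: (derive1_cst c).
exact: (derive1_cst 0).
Qed.

Lemma rsmooth_cst (R : realType) (c : R) : rsmooth (fun=> c).
Proof. by split=> -[|n] x; rewrite ?derive1n_cst; exact: derivable_cst. Qed.

Lemma derive1_shift (R : realType) (r : R -> R) (a : R) :
  (fun t => r (t + a))^`()%classic = (fun t => r^`()%classic (t + a)).
Proof.
by apply/funext => x; rewrite /derive1; under eq_fun do rewrite -addrA.
Qed.

Lemma derive1n_shift (R : realType) (r : R -> R) (a : R) (n : nat) :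
  derive1n n (fun t => r (t + a)) = (fun t => derive1n n r (t + a)).
Proof. by elim: n => // n IHn; rewrite derive1nS IHn derive1_shift. Qed.

Lemma rsmooth_shift (R : realType) (r : R -> R) (a : R) :
  rsmooth r -> rsmooth (fun t => r (t + a)).
Proof.
move=> sr; split=> n x; rewrite derive1n_shift.
apply: ex_derive.
apply: (is_derive1_comp (f := derive1n n r) (g := fun t => t + a)).
exact: rsmooth_is_derive.
Qed.

(** * Bounds on derivatives and Taylor estimates on compact intervals *)

(** Each derivative is bounded by the extreme value theorem, and the bounds for the orders up to [n]
    are added. Strict positivity of [B] allows later radii to be defined as [e / B]. *)
Lemma rsmooth_bounded (R : realType) (r : R -> R) (n : nat) (L : R) :
  rsmooth r -> exists2 B, 0 < B & forall k x, (k <= n)%N -> `|x| <= L ->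
    `|derive1n k r x| <= B.
Proof.
move=> sr.
have bd k : exists2 B, 0 < B & forall x, `|x| <= L -> `|derive1n k r x| <= B.
  have [L0|L0] := leP 0 L; last first.
    by exists 1 => // x xL; have := normr_ge0 x; rewrite leNgt (le_lt_trans xL).
  have := @EVT_max R (fun x => `|derive1n k r x|) (- L) L.
  case; first by lra.
    apply: continuous_subspaceT => x.
    apply: continuous_comp; last exact: norm_continuous.
    exact: rsmooth_continuous.
  move=> c _ cmax; exists (`|derive1n k r c| + 1); first by rewrite ltr_wpDl.
  move=> x xL; apply: ler_wpDr => //; apply: cmax.
  by rewrite in_itv/= -ler_norml.
elim: n => [|n [B1 B10 B1P]].
  have [B B0 BP] := bd 0%N; exists B => // k x.
  by rewrite leqn0 => /eqP ->; exact: BP.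
have [B2 B20 B2P] := bd n.+1; exists (B1 + B2); first exact: addr_gt0.
move=> k x; rewrite leq_eqVlt => /predU1P[->|kn] xL.
  by apply: ler_wpDl; [exact: ltW|exact: B2P].
by apply: ler_wpDr; [exact: ltW|exact: B1P].
Qed.

Lemma rsmooth_lipschitz (R : realType) (r : R -> R) (n : nat) (B L x y : R) :
  rsmooth r ->
  (forall x, `|x| <= L -> `|derive1n n.+1 r x| <= B) ->
  `|x| <= L -> `|y| <= L ->
  `|derive1n n r y - derive1n n r x| <= B * `|y - x|.
Proof.
move=> sr rB.
wlog xy : x y / x <= y => [hw|xL yL].
  have [|/ltW yx xL yL] := leP x y; first exact: hw.
  by rewrite distrC (distrC y); exact: hw.
have [] := @MVT_segment R (derive1n n r) (derive1n n.+1 r) x y xy.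
- by move=> z _; exact: rsmooth_is_derive.
- exact/continuous_subspaceT/rsmooth_continuous.
move=> c; rewrite in_itv/= => /andP[xc cy] ->.
rewrite normrM ler_wpM2r// rB//.
move: xL yL; rewrite !ler_norml => /andP[? _] /andP[_ ?].
by apply/andP; split; lra.
Qed.

(** The mean value theorem for [r^(n)(t) - r^(n+1)(x) t], whose derivative [r^(n+1)(t) - r^(n+1)(x)]
    is controlled by [rsmooth_lipschitz]. This yields the constant [B] instead of the sharp [B / 2],
    which suffices. *)
Lemma rsmooth_taylor1 (R : realType) (r : R -> R) (n : nat) (B L x y : R) :
  rsmooth r ->
  (forall x, `|x| <= L -> `|derive1n n.+2 r x| <= B) ->
  `|x| <= L -> `|y| <= L ->
  `|derive1n n r y - derive1n n r x - derive1n n.+1 r x * (y - x)|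
    <= B * `|y - x| ^+ 2.
Proof.
move=> sr rB xL yL.
pose g t := derive1n n r t - derive1n n.+1 r x * t.
have dg (t : R) : is_derive t 1 g (derive1n n.+1 r t - derive1n n.+1 r x).
  have := is_derive_fctD (rsmooth_is_derive n t sr)
    (is_derive_fctN (is_derive_fctZ (derive1n n.+1 r x) (is_derive_id t 1))).
  by rewrite mulr1.
have B0 : 0 <= B by apply: le_trans (rB _ xL).
have [c cxy gE] : exists2 c, `|c - x| <= `|y - x| /\ `|c| <= L &
    g y - g x = (derive1n n.+1 r c - derive1n n.+1 r x) * (y - x).
  have cg a b : {within `[a, b], continuous g}.
    by apply: derivable_within_continuous => t _; have [] := dg t.
  move: xL yL; rewrite !ler_norml => /andP[x1 x2] /andP[y1 y2].
  have [xy|/ltW yx] := leP x y.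
    have [c + cE] := MVT_segment xy (fun t _ => dg t) (cg _ _).
    rewrite in_itv/= => /andP[c1 c2]; exists c => //.
    split; last by rewrite ler_norml; apply/andP; split; lra.
    by rewrite !ger0_norm ?subr_ge0//; lra.
  have [c + cE] := MVT_segment yx (fun t _ => dg t) (cg _ _).
  rewrite in_itv/= => /andP[c1 c2]; exists c; last first.
    by rewrite -opprB cE -mulrN opprB.
  split; last by rewrite ler_norml; apply/andP; split; lra.
  by rewrite !ler0_norm ?subr_le0//; lra.
rewrite (_ : _ - _ - _ = g y - g x); last by rewrite /g; ring.
rewrite gE normrM expr2 mulrA ler_wpM2r//.
have [cx cL] := cxy.
apply: le_trans (rsmooth_lipschitz sr rB xL cL) _.
by rewrite ler_wpM2l.
Qed.

(** * Convergence of translates and of difference quotients in the seminorms *)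

(** The quotient [(r (t + a + h) - r (t + a)) / h], written as a linear combination so that
    [rsmooth_lin] and [derive1n_lin] apply as they stand. *)
Definition rdiffquot (R : realType) (r : R -> R) (a h : R) : R -> R :=
  fun t => h^-1 * r (t + (a + h)) + - h^-1 * r (t + a).

Lemma rsmooth_diffquot (R : realType) (r : R -> R) (a h : R) :
  rsmooth r -> rsmooth (rdiffquot r a h).
Proof. by move=> sr; apply: rsmooth_lin; exact: rsmooth_shift. Qed.

Lemma derive1n_shift_cvg (R : realType) (r : R -> R) (a e : R) (n : nat) :
  rsmooth r -> 0 < e ->
  exists2 d, 0 < d & forall h k x, `|h| < d -> (k <= n)%N -> `|x| <= n%:R ->
    `|derive1n k (fun t => r (t + (a + h))) x -
      derive1n k (fun t => r (t + a)) x| < e.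
Proof.
move=> sr e0.
have [B B0 BP] := rsmooth_bounded n.+1 (n%:R + `|a| + 1) sr.
(* The bound 1 on [h] keeps [x + a + h] in the interval of radius [n + |a| + 1] on which [B] is
   valid. *)
exists (Num.min 1 (e / B)); first by rewrite lt_min ltr01 divr_gt0.
move=> h k x; rewrite lt_min => /andP[h1 he] kn xn; rewrite !derive1n_shift.
have := @rsmooth_lipschitz _ r k B (n%:R + `|a| + 1) (x + a) (x + (a + h)) sr.
rewrite (_ : x + (a + h) - (x + a) = h); last by ring.
move=> /(_ _ _ _)/le_lt_trans; apply.
- by move=> t tL; apply: BP.
- by have := ler_normD x a; lra.
- by have := ler_normD x (a + h); have := ler_normD a h; lra.
- by rewrite -ltr_pdivlMl// mulrC.
Qed.

(** The error is the first order Taylor remainder, at most [B * h ^+ 2], divided by [|h|]. For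
    orders [k <= n] this takes bounds on the derivatives up to order [n + 2]. *)
Lemma derive1n_diffquot_cvg (R : realType) (r : R -> R) (a e : R) (n : nat) :
  rsmooth r -> 0 < e ->
  exists2 d, 0 < d & forall h k x, `|h| < d -> h != 0 -> (k <= n)%N ->
    `|x| <= n%:R ->
    `|derive1n k (rdiffquot r a h) x -
      derive1n k (fun t => r^`()%classic (t + a)) x| < e.
Proof.
move=> sr e0.
have [B B0 BP] := rsmooth_bounded n.+2 (n%:R + `|a| + 1) sr.
exists (Num.min 1 (e / B)); first by rewrite lt_min ltr01 divr_gt0.
move=> h k x; rewrite lt_min => /andP[h1 he] h0 kn xn.
rewrite derive1n_lin; [|exact: rsmooth_shift|exact: rsmooth_shift].
rewrite !derive1n_shift -derive1Sn.
have := @rsmooth_taylor1 _ r k B (n%:R + `|a| + 1) (x + a) (x + (a + h)) sr.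
rewrite (_ : x + (a + h) - (x + a) = h); last by ring.
move=> /(_ _ _ _) H.
rewrite (_ : _ - _ = h^-1 * (derive1n k r (x + (a + h)) - derive1n k r (x + a)
  - derive1n k.+1 r (x + a) * h)); last by field.
rewrite normrM normfV mulrC ltr_pdivrMr ?normr_gt0//.
apply: le_lt_trans (H _ _ _) _.
- by move=> t tL; apply: BP.
- by have := ler_normD x a; lra.
- by have := ler_normD x (a + h); have := ler_normD a h; lra.
- by rewrite expr2 mulrA ltr_pM2r ?normr_gt0// -ltr_pdivlMl// mulrC.
Qed.

Lemma nat_above (R : realType) (x : R) : exists n : nat, x <= n%:R.
Proof.
exists (Num.bound `|x|); apply: le_trans (ler_norm x) _.
exact/ltW/archi_boundP.
Qed.

Lemma is_derive_epsP (R : realType) (w : R -> R) (x l : R) :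
  is_derive x 1 w l <->
  (forall e, 0 < e -> exists2 d, 0 < d & forall h, h != 0 -> `|h| < d ->
    `|h^-1 * (w (x + h) - w x) - l| < e).
Proof.
have E h : h^-1 *: (w (h *: 1 + x) - w x) = h^-1 * (w (x + h) - w x).
  by rewrite [_%:A]mulr1 (addrC h).
have cvgP_ : (h^-1 *: (w (h *: 1 + x) - w x) @[h --> 0^'] --> l) <->
    (forall e, 0 < e -> exists2 d, 0 < d & forall h, h != 0 -> `|h| < d ->
      `|h^-1 * (w (x + h) - w x) - l| < e).
  split => [/cvgrPdist_lt H e /H|H].
    rewrite near_withinE => -[d /= d0 dP]; exists d => // h h0 hd.
    have := dP h; rewrite /= sub0r normrN => /(_ hd h0).
    by rewrite E distrC.
  apply/cvgrPdist_lt => e /H [d d0 dP]; rewrite near_withinE.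
  exists d => // h /=; rewrite sub0r normrN => hd h0.
  by rewrite E distrC; exact: dP.
split => [[dw dwl]|/cvgP_ H]; first by apply/cvgP_; rewrite -dwl; exact: dw.
by apply: DeriveDef; [exact: cvgP H|exact/cvg_lim].
Qed.

(** * Complex-valued smooth functions and their seminorm balls *)

Lemma smoothE (R : realType) (f : R -> R[i]) :
  smooth f <-> rsmooth (Ref f) /\ rsmooth (Imf f).
Proof.
split=> [sf|[[sr] [si]] n x]; last by split; [exact: sr|exact: si].
by split; split=> n x; have [] := sf n x.
Qed.

Lemma cderiven_complex (R : realType) (f : R -> R[i]) (n : nat) (x : R) :
  cderiven n f x = derive1n n (Ref f) x +i* derive1n n (Imf f) x.
Proof.
suff [<- <-] : Ref (cderiven n f) = derive1n n (Ref f) /\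
    Imf (cderiven n f) = derive1n n (Imf f).
  by rewrite /Ref /Imf; case: (cderiven n f x).
elim: n => // n [IHr IHi]; rewrite !derive1nS -IHr -IHi.
by split; apply/funext.
Qed.

Lemma normc_le (R : realType) (a b : R) : `|a +i* b| <= (`|a| + `|b|)%:C.
Proof.
rewrite normc_def /= lecR -(@ger0_norm _ (`|a| + `|b|)) ?addr_ge0//.
rewrite -sqrtr_sqr ler_wsqrtr// sqrrD !real_normK ?num_real// -addrA lerD2l.
by rewrite lerDr mulrn_wge0// mulr_ge0.
Qed.

Lemma smooth_ball_intro (R : realType) (f g : R -> R[i]) (n : nat) (e : R) :
  smooth g ->
  (forall k x, (k <= n)%N -> `|x| <= n%:R ->
    `|derive1n k (Ref g) x - derive1n k (Ref f) x| < e / 2 /\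
    `|derive1n k (Imf g) x - derive1n k (Imf f) x| < e / 2) ->
  smooth_ball n f e g.
Proof.
move=> sg H; split=> // k x kn xn; have [Hr Hi] := H k x kn xn.
rewrite !cderiven_complex.
apply: le_lt_trans (normc_le _ _) _.
by rewrite ltcR /=; lra.
Qed.

Lemma smooth_ball_Re (R : realType) (f g : R -> R[i]) (n : nat) (e x : R) :
  smooth_ball n f e g -> `|x| <= n%:R ->
  `|complex.Re (g x) - complex.Re (f x)| < e.
Proof.
move=> [_ /(_ 0%N x (leq0n n)) H] xn.
have := le_lt_trans (normc_ge_Re (g x - f x)) (H xn).
by rewrite ltcR raddfB.
Qed.

Lemma smooth_shift (R : realType) (f : R -> R[i]) (a : R) :
  smooth f -> smooth (fun t => f (t + a)).
Proof.
move=> /smoothE[sr si]; apply/smoothE.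
by split; [exact: (rsmooth_shift _ sr)|exact: (rsmooth_shift _ si)].
Qed.

Lemma smooth_cderive (R : realType) (f : R -> R[i]) :
  smooth f -> smooth (cderive f).
Proof.
move=> /smoothE[sr si]; apply/smoothE.
by split; [exact: (rsmooth_derive1 sr)|exact: (rsmooth_derive1 si)].
Qed.

Lemma smooth_lin (R : realType) (f g : R -> R[i]) (a : R[i]) :
  smooth f -> smooth g -> smooth (fun t => a * f t + g t).
Proof.
move=> /smoothE[fr fi] /smoothE[gr gi]; apply/smoothE; split.
- have := rsmooth_lin 1 1
    (rsmooth_lin (complex.Re a) (- complex.Im a) fr fi) gr.
  congr rsmooth; apply/funext => t; rewrite /Ref /Imf.
  by case: a (f t) (g t) => [? ?] [? ?] [? ?] /=; ring.
- have := rsmooth_lin 1 1 (rsmooth_lin (complex.Re a) (complex.Im a) fi fr) gi.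
  congr rsmooth; apply/funext => t; rewrite /Ref /Imf.
  by case: a (f t) (g t) => [? ?] [? ?] [? ?] /=; ring.
Qed.

Lemma cderive_shift (R : realType) (f : R -> R[i]) (a : R) :
  cderive (fun t => f (t + a)) = (fun t => cderive f (t + a)).
Proof.
apply/funext => x; rewrite /cderive.
congr Complex.
  exact: (congr1 (@^~ x) (derive1_shift (Ref f) a)).
exact: (congr1 (@^~ x) (derive1_shift (Imf f) a)).
Qed.

Lemma shift_smooth_ball (R : realType) (f : R -> R[i]) (a e : R) (n : nat) :
  smooth f -> 0 < e ->
  exists2 d, 0 < d & forall h, `|h| < d ->
    smooth_ball n (fun t => f (t + a)) e (fun t => f (t + (a + h))).
Proof.
move=> sf e0; have /smoothE[sr si] := sf.
have e20 : 0 < e / 2 by rewrite divr_gt0.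
have [d1 d10 H1] := derive1n_shift_cvg a n sr e20.
have [d2 d20 H2] := derive1n_shift_cvg a n si e20.
exists (Num.min d1 d2); first by rewrite lt_min d10 d20.
move=> h; rewrite lt_min => /andP[hd1 hd2].
apply: smooth_ball_intro; first exact: smooth_shift.
by move=> k x kn xn; split; [exact: H1|exact: H2].
Qed.

Definition diffquot (R : realType) (f : R -> R[i]) (a h : R) : R -> R[i] :=
  fun t => rdiffquot (Ref f) a h t +i* rdiffquot (Imf f) a h t.

Lemma smooth_diffquot (R : realType) (f : R -> R[i]) (a h : R) :
  smooth f -> smooth (diffquot f a h).
Proof.
move=> /smoothE[sr si]; apply/smoothE.
by split; [exact: (rsmooth_diffquot a h sr)|exact: (rsmooth_diffquot a h si)].
Qed.

(** Puts a translate of [f] in the form to which linearity of an operator applies. *)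
Lemma diffquotK (R : realType) (f : R -> R[i]) (a h : R) : h != 0 ->
  (fun t => f (t + (a + h))) = (fun t => h%:C * diffquot f a h t + f (t + a)).
Proof.
move=> h0; apply/funext => t; rewrite /diffquot /rdiffquot /Ref /Imf.
case: (f (t + (a + h))) (f (t + a)) => [r1 i1] [r2 i2].
by apply/eqP; rewrite eq_complex /=; apply/andP; split; apply/eqP; field.
Qed.

(** The translates of [f] are differentiable in [a] for the Frechet topology. A continuous linear
    operator may therefore be differentiated along them. *)
Lemma diffquot_smooth_ball (R : realType) (f : R -> R[i]) (a e : R) (n : nat) :
  smooth f -> 0 < e ->
  exists2 d, 0 < d & forall h, `|h| < d -> h != 0 ->
    smooth_ball n (cderive (fun t => f (t + a))) e (diffquot f a h).
Proof.
move=> sf e0; have /smoothE[sr si] := sf.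
have e20 : 0 < e / 2 by rewrite divr_gt0.
have [d1 d10 H1] := derive1n_diffquot_cvg a n sr e20.
have [d2 d20 H2] := derive1n_diffquot_cvg a n si e20.
exists (Num.min d1 d2); first by rewrite lt_min d10 d20.
move=> h; rewrite lt_min => /andP[hd1 hd2] h0.
apply: smooth_ball_intro; first exact: smooth_diffquot.
move=> k x kn xn; rewrite cderive_shift.
by split; [exact: H1|exact: H2].
Qed.

(** * The intertwining operator *)

Definition cherednik_coef (R : realType) (k1 k2 x : R) : R :=
  k1 / (1 - expR (- x)) + 2 * k2 / (1 - expR (- (2 * x))).

Lemma inv1BexpR_sign (R : realType) (x : R) : 0 <= x * (1 - expR (- x))^-1.
Proof.
have [x0|x0] := leP 0 x.
  by rewrite mulr_ge0// invr_ge0 subr_ge0 expR_le1 oppr_le0.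
rewrite mulr_le0 ?invr_le0 ?subr_le0 ?(ltW x0)//.
by rewrite -expR0 ler_expR oppr_ge0 ltW.
Qed.

(** The least value of [|1 - expR (- x)|] on [|x| >= r] is the one at [x = r]: on the negative side,
    [expR (- x) - 1 >= r >= 1 - expR (- r)]. *)
Lemma inv1BexpR_bounded (R : realType) (r x : R) : 0 < r -> r <= `|x| ->
  `|(1 - expR (- x))^-1| <= (1 - expR (- r))^-1.
Proof.
move=> r0 rx.
have er : expR (- r) < 1 by rewrite expR_lt1 oppr_lt0.
have h : 0 < 1 - expR (- r) by rewrite subr_gt0.
suff H : 1 - expR (- r) <= `|1 - expR (- x)|.
  by rewrite normfV lef_pV2// posrE (lt_le_trans h).
have [x0|x0] := leP 0 x.
  have {}rx : r <= x by rewrite ger0_norm in rx.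
  have ex : expR (- x) <= expR (- r) by rewrite ler_expR lerN2.
  by apply: le_trans (ler_norm _); lra.
have {}rx : r <= - x by rewrite ltr0_norm in rx.
have ex : 1 + r <= expR (- x).
  by apply: le_trans (expR_ge1Dx _) _; rewrite ler_expR.
have := expR_ge1Dx (- r).
by rewrite -normrN; have := ler_norm (- (1 - expR (- x))); lra.
Qed.

Lemma cherednik_coef_sign (R : realType) (k1 k2 x : R) : 0 < k1 -> 0 < k2 ->
  0 <= x * cherednik_coef k1 k2 x.
Proof.
move=> k10 k20; rewrite /cherednik_coef.
rewrite (_ : x * _ = k1 * (x * (1 - expR (- x))^-1)
  + k2 * ((2 * x) * (1 - expR (- (2 * x)))^-1)); last by ring.
by rewrite addr_ge0// mulr_ge0 ?inv1BexpR_sign ?ltW.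
Qed.

Lemma cherednik_coef_bounded (R : realType) (k1 k2 r : R) : 0 < r ->
  exists M, forall x, r <= `|x| -> `|cherednik_coef k1 k2 x| <= M.
Proof.
move=> r0; exists (`|k1| * (1 - expR (- r))^-1 +
  `|2 * k2| * (1 - expR (- (2 * r)))^-1) => x rx.
apply: le_trans (ler_normD _ _) _; rewrite !normrM.
apply: lerD; apply: ler_wpM2l => //; rewrite ?mulr_ge0//.
  exact: inv1BexpR_bounded.
apply: inv1BexpR_bounded; first by rewrite mulr_gt0.
by rewrite normrM ger0_norm// ler_wpM2l.
Qed.

(** * Positivity of the intertwining operator through the transport equation *)

Section IntertwiningPositivity.
Context {R : realType}.

(** The function [u] of the introduction, on pairs so that joint continuity can be stated. *)
Definition transport (V : (R -> R[i]) -> R -> R[i]) (f : R -> R[i])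
    (p : R * R) : R :=
  complex.Re (V (fun t => f (t + p.2)) p.1).

Lemma Re_cherednik (k1 k2 : R) (g : R -> R[i]) (x : R) : x != 0 ->
  complex.Re (cherednik k1 k2 g x) =
  (Ref g)^`()%classic x
  + cherednik_coef k1 k2 x * (complex.Re (g x) - complex.Re (g (- x)))
  - (k1 / 2 + k2) * complex.Re (g x).
Proof.
move=> x0; rewrite /cherednik (negbTE x0) /cherednik_formula /cherednik_coef.
rewrite /cderive; case: (g x) (g (- x)) => [a b] [c d] /=.
by rewrite !mul0r !subr0.
Qed.

(** Moving [x] first and [a] next, the first change is small because [V (f (. + a))] is smooth, and
    the second because [V] is continuous, uniformly for points of absolute value at most [n]. *)
Lemma transport_continuous (k1 k2 : R) (V : (R -> R[i]) -> R -> R[i])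
    (f : R -> R[i]) :
  intertwining_operator k1 k2 V -> smooth f -> continuous (transport V f).
Proof.
move=> hV sf -[x a]; apply/cvgrPdist_lt => e e0.
(* This [n] makes the seminorms of order [n] control every point at distance less than 1 from
   [x]. *)
have [n xn] := nat_above (`|x| + 1).
have e20 : 0 < e / 2 by rewrite divr_gt0.
have sfa : smooth (fun t => f (t + a)) by exact: smooth_shift.
have [m [d [d0 dP]]] := intertwining_continuous hV sfa n e20.
have [d' d'0 d'P] := shift_smooth_ball a m sf d0.
have /smoothE[sV _] := intertwining_smooth hV sfa.
have /cvgrPdist_lt/(_ _ e20) := rsmooth_continuous (n := 0%N) (x := x) sV.
rewrite -!nbhs_ballE/= => -[d2 /= d20 d2P].
pose r := Num.min 1 (Num.min d' d2).
have r0 : 0 < r by rewrite !lt_min ltr01 d'0 d20.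
exists (ball x r, ball a r); first by split; exists r.
move=> -[y b] [/= xy ab].
have xy1 : `|x - y| < 1 by move: xy; rewrite /ball/= !lt_min => /andP[].
have abd : `|b - a| < d'.
  by rewrite distrC; move: ab; rewrite /ball/= !lt_min => /and3P[].
have xyd2 : ball x d2 y.
  by rewrite /ball/=; move: xy; rewrite /ball/= !lt_min => /and3P[].
have yn : `|y| <= n%:R.
  have := ler_normD x (y - x); rewrite (addrC x) subrK distrC; lra.
have /dP /smooth_ball_Re /(_ yn) := d'P _ abd.
rewrite (_ : a + (b - a) = b); last by ring.
have := d2P _ xyd2; rewrite /transport /Ref /=.
move=> h1 h2; rewrite -(subrK (complex.Re (V (fun t => f (t + a)) y))
  (complex.Re (V (fun t => f (t + a)) x))) -addrA.
apply: le_lt_trans (ler_normD _ _) _.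
by rewrite distrC in h2; lra.
Qed.

(* [d/da V (f (. + a)) = V (f' (. + a)) = D V (f (. + a))], so that along
   [a = b - x] the derivative of [V (f (. + a)) x] in [x] cancels. *)
Lemma transport_is_derive (k1 k2 : R) (V : (R -> R[i]) -> R -> R[i])
    (f : R -> R[i]) (x b : R) :
  intertwining_operator k1 k2 V -> smooth f -> x != 0 ->
  is_derive x 1 (fun t => transport V f (t, b - t))
    (- cherednik_coef k1 k2 x *
       (transport V f (x, b - x) - transport V f (- x, b - x))
     + (k1 / 2 + k2) * transport V f (x, b - x)).
Proof.
move=> hV sf x0.
pose a := b - x; pose fa t := f (t + a).
have sfa : smooth fa by exact: smooth_shift.
have sdfa : smooth (cderive fa) by exact: smooth_cderive.
have /smoothE[sV _] := intertwining_smooth hV sfa.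
have /smoothE[sVd _] := intertwining_smooth hV sdfa.
pose U := Ref (V fa); pose D := Ref (V (cderive fa)).
have DE : D x = U^`()%classic x + cherednik_coef k1 k2 x * (U x - U (- x))
    - (k1 / 2 + k2) * U x.
  by rewrite /D {1}/Ref (intertwining_derive hV sfa) Re_cherednik.
suff : is_derive x 1 (fun t => transport V f (t, b - t))
    (U^`()%classic x - D x).
  by apply: is_derive_fct; rewrite DE /U /Ref /transport /fa /=; ring.
apply/is_derive_epsP => e e0.
have e30 : 0 < e / 3 by rewrite divr_gt0.
have [n xn] := nat_above (`|x| + 1).
have [m [d [d0 dP]]] := intertwining_continuous hV sdfa n e30.
have [d1 d10 d1P] := diffquot_smooth_ball a m sf d0.
have : is_derive x 1 U (U^`()%classic x) by exact: (rsmooth_is_derive 0 x sV).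
move=> /is_derive_epsP /(_ _ e30)[d2 d20 d2P].
have /cvgrPdist_lt/(_ _ e30) := rsmooth_continuous (n := 0%N) (x := x) sVd.
rewrite -!nbhs_ballE/= => -[d3 /= d30 d3P].
exists (Num.min (Num.min 1 d1) (Num.min d2 d3)).
  by rewrite !lt_min ltr01 d10 d20 d30.
move=> h h0; rewrite !lt_min => /andP[/andP[h1 hd1] /andP[hd2 hd3]].
have Nh0 : - h != 0 by rewrite oppr_eq0.
have xhn : `|x + h| <= n%:R by have := ler_normD x h; lra.
have /dP /smooth_ball_Re /(_ xhn) H1 : smooth_ball m (cderive fa) d
    (diffquot f a (- h)) by apply: d1P; rewrite ?normrN.
have H2 := d2P h h0 hd2.
have /d3P H3 : ball x d3 (x + h).
  by rewrite /ball/= opprD addrA subrr add0r normrN.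
pose Q := complex.Re (V (diffquot f a (- h)) (x + h)).
(* Along the line, an increment [h] of [x] is an increment [- h] of [a]; linearity isolates its
   effect. *)
have QE : transport V f (x + h, b - (x + h)) = - h * Q + U (x + h).
  rewrite /transport /= (_ : b - (x + h) = a + - h); last by rewrite /a; ring.
  rewrite (diffquotK _ _ Nh0) (intertwining_linear hV)//.
    rewrite /Q /U /Ref; case: (V (diffquot f a (- h)) (x + h)) => [? ?].
    by case: (V fa (x + h)) => [? ?] /=; rewrite mul0r subr0.
  exact: smooth_diffquot.
rewrite QE (_ : transport V f (x, b - x) = U x)//.
(* Three errors, each below [e / 3]: the difference quotient of [U], the replacement of the quotient
   in [a] by [cderive fa] under [V], and the continuity of [D] at [x]. *)
rewrite (_ : _ - _ = (h^-1 * (U (x + h) - U x) - U^`()%classic x)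
  + - (Q - D (x + h)) + (D x - D (x + h))); last by field.
have := ler_normD ((h^-1 * (U (x + h) - U x) - U^`()%classic x)
  + - (Q - D (x + h))) (D x - D (x + h)).
have := ler_normD (h^-1 * (U (x + h) - U x) - U^`()%classic x)
  (- (Q - D (x + h))).
rewrite normrN.
move: H1 H2 H3; rewrite -/Q -/(D (x + h)) => H1 H2 H3.
by lra.
Qed.

Lemma intertwining_Re_gt0 (k1 k2 : R) (V : (R -> R[i]) -> R -> R[i])
    (f : R -> R[i]) :
  0 < k1 -> 0 < k2 ->
  intertwining_operator k1 k2 V -> smooth f ->
  (forall x, 0 < complex.Re (f x)) -> forall x, 0 < complex.Re (V f x).
Proof.
move=> k10 k20 hV sf f0 x.
have := @reflection_transport_gt0 _ (transport V f) (cherednik_coef k1 k2)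
  (k1 / 2 + k2) (transport_continuous hV sf) _ _ _ _ x 0.
have -> : transport V f (x, 0) = complex.Re (V f x).
  by rewrite /transport /=; under eq_fun do rewrite addr0.
apply.
- by move=> y; exact: cherednik_coef_sign.
- by move=> r r0; exact: cherednik_coef_bounded.
- by move=> y b y0; exact: transport_is_derive.
- move=> a; rewrite /transport /= (intertwining_at0 hV) ?add0r//.
  exact: smooth_shift.
Qed.

Lemma smooth_cst (c : R[i]) : smooth (fun=> c : R[i]).
Proof. by apply/smoothE; split; exact: rsmooth_cst. Qed.

Lemma intertwining_Re_ge0 (k1 k2 : R) (V : (R -> R[i]) -> R -> R[i])
    (f : R -> R[i]) :
  0 < k1 -> 0 < k2 ->
  intertwining_operator k1 k2 V -> smooth f ->
  (forall x, 0 <= complex.Re (f x)) -> forall x, 0 <= complex.Re (V f x).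
Proof.
move=> k10 k20 hV sf f0 x.
have s1 : smooth (fun=> 1 : R[i]) by exact: smooth_cst.
pose c := complex.Re (V (fun=> 1) x).
have H e : 0 < e -> 0 < e * c + complex.Re (V f x).
  move=> e0; have := @intertwining_Re_gt0 k1 k2 V
    (fun t => e%:C * 1 + f t) k10 k20 hV (smooth_lin _ s1 sf) _ x.
  rewrite (intertwining_linear hV)// /c.
  case: (V (fun=> 1) x) => [p q]; case: (V f x) => [r s] /=.
  rewrite mul0r subr0; apply => y; have := f0 y; case: (f y) => [u v] /=.
  by rewrite mul0r subr0 mulr1; lra.
rewrite leNgt; apply/negP => Vf0.
(* For this [e], [e * c + Re (V f x) <= e * |c| - e * (1 + |c|) = - e < 0], against [H]. *)
pose e := - complex.Re (V f x) / (1 + `|c|).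
have c1 : 0 < 1 + `|c| by rewrite ltr_wpDr.
have e0 : 0 < e by rewrite divr_gt0// oppr_gt0.
have := H _ e0; have : e * c <= e * `|c| by rewrite ler_wpM2l ?ler_norm// ltW.
have : e * (1 + `|c|) = - complex.Re (V f x) by rewrite divfK// gt_eqF.
by lra.
Qed.

(** In the order of [R[i]], [0 <= z] includes that [z] is real, so the imaginary part of [V f] has
    to be shown to vanish. *)
Lemma intertwining_ge0 (k1 k2 : R) (V : (R -> R[i]) -> R -> R[i])
    (f : R -> R[i]) :
  0 < k1 -> 0 < k2 ->
  intertwining_operator k1 k2 V -> smooth f ->
  (forall x, 0 <= f x) -> forall x, 0 <= V f x.
Proof.
move=> k10 k20 hV sf f0 x.
have fr y : complex.Im (f y) = 0 /\ 0 <= complex.Re (f y).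
  by have := f0 y; rewrite lecE => /andP[/eqP -> ->].
have Re0 : 0 <= complex.Re (V f x).
  by apply: (intertwining_Re_ge0 k10 k20 hV sf) => y; have [] := fr y.
rewrite lecE /= Re0 andbT; apply/eqP; apply: contrapT => /eqP Im0.
(* As [f] is real, [Re (i l f + f) = Re f >= 0] for every real [l]; hence
   [Re (V f) - l Im (V f) >= 0] for every real [l]. *)
have H l : 0 <= - l * complex.Im (V f x) + complex.Re (V f x).
  have := @intertwining_Re_ge0 k1 k2 V
    (fun t => (0 +i* l) * f t + f t) k10 k20 hV (smooth_lin _ sf sf) _ x.
  rewrite (intertwining_linear hV)//.
  case: (V f x) => [r s] /=; rewrite mul0r sub0r mulNr; apply => y.
  have := fr y; case: (f y) => [u v] /= [-> ?].
  by rewrite mul0r mulr0 subr0 add0r.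
(* This [l] makes the expression in [H] equal to -1. *)
have := H ((complex.Re (V f x) + 1) / complex.Im (V f x)).
by rewrite mulNr divfK//; lra.
Qed.

End IntertwiningPositivity.

(** * The dual operator *)

Lemma Rintegral_ge_itv (R : realType) (D : set R) (g : R -> R) (a b c : R) :
  measurable D -> lebesgue_measure.-integrable D (EFin \o g) ->
  `[a, b] `<=` D -> a <= b -> 0 <= c ->
  (forall x, D x -> 0 <= g x) -> (forall x, x \in `[a, b] -> c <= g x) ->
  c * (b - a) <= \int[lebesgue_measure]_(x in D) g x.
Proof.
move=> mD ig abD ab c0 g0 gc.
have mg := measurable_int _ ig.
rewrite -lee_fin /Rintegral fineK; last exact: integrable_fin_num.
apply: (@le_trans _ _ (\int[lebesgue_measure]_(x in `[a, b]) (g x)%:E)%E).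
  apply: (@le_trans _ _ (\int[lebesgue_measure]_(x in `[a, b]) (cst c%:E x))%E).
    rewrite integral_cst// [X in (_ <= _ * X)%E]lebesgue_measure_itv/= lte_fin.
    have [_|ba] := ltP a b; first by rewrite -EFinB -EFinM.
    by rewrite mule0 lee_fin mulr_ge0_le0// subr_le0.
  by apply: ge0_le_integral => //; exact: measurable_funS mg.
by apply: ge0_subset_integral => // x /g0; rewrite lee_fin.
Qed.

Lemma Rintegral_support (R : realType) (f : R -> R) (L : R) :
  (forall x, f x != 0 -> `|x| <= L) ->
  \int[lebesgue_measure]_x f x = \int[lebesgue_measure]_(x in `[- L, L]) f x.
Proof.
move=> fL; rewrite [RHS]Rintegral_mkcond; apply: eq_Rintegral => x _.
rewrite patchE; case: ifPn => // /negP xD.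
have [//|/fL xL] := eqVneq (f x) 0.
by exfalso; apply: xD; rewrite inE /= in_itv/= -ler_norml.
Qed.

(** * Products and powers of smooth functions *)

Inductive sum_of_products (R : realType) : (R -> R) -> Prop :=
| Product f g : rsmooth f -> rsmooth g -> sum_of_products (fun t => f t * g t)
| Sum f g : sum_of_products f -> sum_of_products g ->
    sum_of_products (fun t => f t + g t).

(* The sums of products of smooth functions form a class of differentiable
   functions that is closed under differentiation. *)
Lemma rsmoothM (R : realType) (f g : R -> R) :
  rsmooth f -> rsmooth g -> rsmooth (fun t => f t * g t).
Proof.
have closed (h : R -> R) : sum_of_products h ->
    sum_of_products h^`()%classic /\ forall x, derivable h x 1.
  elim=> {h f g} [f g sf sg|f g _ [Sf df] _ [Sg dg]].
    have d x := is_derive_fctM (rsmooth_is_derive 0 x sf)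
      (rsmooth_is_derive 0 x sg).
    split=> [|x]; last by have [] := d x.
    rewrite (_ : _^`()%classic =
        fun x => f^`()%classic x * g x + f x * g^`()%classic x).
      by apply: Sum; apply: Product => //; exact: rsmooth_derive1.
    by apply/funext => x; rewrite derive1E; have [_ ->] := d x.
  have d x := is_derive_fctD (derivableP (df x)) (derivableP (dg x)).
  split=> [|x]; last by have [] := d x.
  rewrite (_ : _^`()%classic = fun x => f^`()%classic x + g^`()%classic x).
    exact: Sum.
  by apply/funext => x; rewrite derive1E; have [_ ->] := d x; rewrite !derive1E.
move=> sf sg; split=> n; have := Product sf sg.
move: (fun t => _) => h; elim: n h => [|n IHn] h /closed[Sh dh] //.
by rewrite derive1Sn; exact: IHn.
Qed.

Lemma rsmoothX (R : realType) (f : R -> R) (n : nat) :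
  rsmooth f -> rsmooth (fun t => f t ^+ n).
Proof.
move=> sf; elim: n => [|n IHn]; first exact: rsmooth_cst.
rewrite (_ : (fun t => _) = fun t => f t * f t ^+ n); first exact: rsmoothM.
by apply/funext => t; rewrite exprS.
Qed.

(** Serves to bound [s (1 - s)^n] by [1 / n]. The induction rests on [(1 + (n + 1) s) (1 - s) = 1 +
    n s - (n + 1) s^2 <= 1 + n s]. *)
Lemma onem_exp_le (R : realType) (s : R) (n : nat) : 0 <= s -> s <= 1 ->
  (1 + n%:R * s) * (1 - s) ^+ n <= 1.
Proof.
move=> s0 s1; elim: n => [|n]; first by rewrite mul0r addr0 mulr1.
apply: le_trans; rewrite exprS mulrA ler_wpM2r//.
  by rewrite exprn_ge0// subr_ge0.
rewrite -natr1; have := sqr_ge0 s; have := ler0n R n.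
nra.
Qed.

(* The weights [(1 - r / B) ^+ n], with [n] even and large, concentrate where
   [r] is negative. *)
Lemma rsmooth_ge0_of_integral (R : realType) (r : R -> R) (L : R) :
  rsmooth r -> (forall x, r x != 0 -> `|x| <= L) ->
  (forall p : R -> R, rsmooth p -> (forall x, 0 <= p x) ->
    0 <= \int[lebesgue_measure]_x (p x * r x)) ->
  forall x, 0 <= r x.
Proof.
move=> sr rL rint x0; rewrite leNgt; apply/negP => rx0.
have x0L : `|x0| <= L by apply: rL; rewrite lt_eqF.
have L0 : 0 <= L by exact: le_trans x0L.
have [B B0 BP] := rsmooth_bounded 0 L sr.
have rB x : `|r x| <= B.
  have [->|/rL xL] := eqVneq (r x) 0; first by rewrite normr0 ltW.
  exact: (BP 0%N x).
(* Half the depth of [r] at [x0]: by continuity [r <= - c] on an interval of length [d] around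
   [x0]. *)
pose c := - r x0 / 2.
have c0 : 0 < c by rewrite divr_gt0// oppr_gt0.
have cr := rsmooth_continuous (n := 0%N) sr.
have /cvgrPdist_lt/(_ _ c0) := cr x0.
rewrite -!nbhs_ballE/= => -[d /= d0 dP].
have rc x : x \in `[x0 - d / 2, x0 + d / 2] -> r x <= - c.
  rewrite in_itv/= => /andP[x1 x2].
  have /dP : ball x0 d x.
    by rewrite /ball/= ltr_norml; apply/andP; split; lra.
  by rewrite ltr_norml /c => /andP[h1 h2]; lra.
have [N NP] : exists N : nat, B * (2 * L) < N%:R * (c * d).
  exists (Num.bound (B * (2 * L) / (c * d))).
  rewrite -ltr_pdivrMr; last exact: mulr_gt0.
  have h : 0 <= B * (2 * L) / (c * d).
    apply: divr_ge0; last exact/ltW/mulr_gt0.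
    by rewrite mulr_ge0 ?mulr_ge0// ltW.
  exact: archi_boundP h.
(* The even exponent makes [p] nonnegative, and [m >= N] gives [B / m * (2 * L) < c * d]. *)
pose m := (2 * N.+1)%N.
have m0 : 0 < m%:R :> R by rewrite ltr0n.
pose p x := (1 + - B^-1 * r x) ^+ m.
have sp : rsmooth p.
  apply: rsmoothX.
  have := rsmooth_lin 1 (- B^-1) (rsmooth_cst 1) sr.
  by rewrite (_ : (fun t => _ + _) = (fun t => 1 + - B^-1 * r t))//;
    apply/funext => t; rewrite mulr1.
have p0 x : 0 <= p x by rewrite /p /m exprM exprn_ge0// sqr_ge0.
have sB x : - 1 <= B^-1 * r x <= 1.
  rewrite -ler_norml normrM normfV (gtr0_norm B0) mulrC ler_pdivrMr// mul1r.
  exact: rB.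
(* Where [r >= 0] this is [onem_exp_le] with [s = r / B]; elsewhere the product is nonpositive. *)
have pr1 x : p x * r x <= B / m%:R.
  have [r0|r0] := leP 0 (r x); last first.
    apply: (@le_trans _ _ 0); first by rewrite mulr_ge0_le0// ltW.
    by rewrite divr_ge0// ltW.
  have s0 : 0 <= B^-1 * r x by rewrite mulr_ge0// invr_ge0 ltW.
  have /andP[_ s1] := sB x.
  have := onem_exp_le m s0 s1; have := p0 x; rewrite /p mulNr.
  set q := (1 - _) ^+ m => q0 H.
  rewrite ler_pdivlMr// (_ : q * r x * m%:R = B * (m%:R * (B^-1 * r x) * q)).
    by rewrite -[leRHS]mulr1 ler_pM2l//; lra.
  by field; rewrite gt_eqF.
have pr2 x : x \in `[x0 - d / 2, x0 + d / 2] -> p x * r x <= - c.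
  move=> /rc rxc; have p1 : 1 <= p x.
    rewrite /p exprn_ege1// mulNr lerDl oppr_ge0 mulr_ge0_le0 ?invr_ge0 ?ltW//.
    by apply: le_lt_trans rxc _; rewrite oppr_lt0.
  by nra.
have {rint} := rint p sp p0.
rewrite leNgt => /negP; apply.
pose D := `[- L, L]%classic : set R.
rewrite (@Rintegral_support _ _ L); last first.
  by move=> x h; apply: rL; apply: contraNneq h => ->; rewrite mulr0.
have cD : compact D by exact: segment_compact.
have mD : measurable D by exact: measurable_itv.
have cpr := rsmooth_continuous (n := 0%N) (rsmoothM sp sr).
have ipr : lebesgue_measure.-integrable D (EFin \o (fun x => p x * r x)).
  apply: continuous_compact_integrable => //; apply: continuous_subspaceT.
  exact: cpr.
have icst : lebesgue_measure.-integrable D (EFin \o (fun=> B / m%:R)).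
  apply: continuous_compact_integrable => //; apply: continuous_subspaceT.
  by move=> x; exact: cvg_cst.
have IE : \int[lebesgue_measure]_(x in D) (B / m%:R - p x * r x) =
    B / m%:R * (2 * L) - \int[lebesgue_measure]_(x in D) (p x * r x).
  rewrite RintegralB// Rintegral_cst// /D.
  rewrite [X in fine X]lebesgue_measure_itv/= lte_fin.
  by congr (_ * _ - _); case: ltP => /= h; lra.
(* The function [B / m - p r] is nonnegative and is at least [c] on the interval around [x0], so its
   integral over [[- L, L]] is at least [c * d]. This makes the integral of [p r] negative. *)
have : c * (x0 + d / 2 - (x0 - d / 2)) <=
   B / m%:R * (2 * L) - \int[lebesgue_measure]_(x in D) (p x * r x).
  rewrite -IE; apply: Rintegral_ge_itv => //.
  - apply: continuous_compact_integrable => //; apply: continuous_subspaceT.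
    by move=> x; apply: cvgB; [exact: cvg_cst|exact: cpr].
  - move=> x /rc rxc; rewrite /D/= in_itv/= -ler_norml; apply: rL.
    by rewrite lt_eqF//; apply: le_lt_trans rxc _; rewrite oppr_lt0.
  - by lra.
  - exact: ltW.
  - by move=> x _; rewrite subr_ge0.
  - move=> x /pr2; have : 0 <= B / m%:R by rewrite divr_ge0// ltW.
    by lra.
rewrite (_ : _ + _ - _ = d); last by field.
have : B / m%:R * (2 * L) < c * d.
  rewrite mulrAC ltr_pdivrMr//; apply: lt_le_trans NP _.
  rewrite [leRHS]mulrC; apply: ler_wpM2r; first exact/ltW/mulr_gt0.
  by rewrite ler_nat /m mulSn addSn mul1n -addnS; apply: leq_addr.
by lra.
Qed.

(** * Positivity of the dual operator *)

Lemma cintegral_ge0 (R : realType) (f : R -> R[i]) :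
  (forall x, 0 <= f x) -> 0 <= cintegral f.
Proof.
move=> f0; have fr x : complex.Im (f x) = 0 /\ 0 <= complex.Re (f x).
  by have := f0 x; rewrite lecE => /andP[/eqP -> ->].
rewrite lecE /=; apply/andP; split.
  rewrite (eq_Rintegral _ (g := fun=> 0)); last by move=> x _; have [] := fr x.
  by rewrite Rintegral_cst// mul0r.
by apply: Rintegral_ge0 => x _; have [] := fr x.
Qed.

Lemma test_function_bounded (R : realType) (h : R -> R[i]) :
  test_function h -> exists L, forall x, h x != 0 -> `|x| <= L.
Proof.
move=> [_ /compact_bounded[M [_ MP]]]; exists (M + 1) => x hx.
by apply: MP; [rewrite ltrDl|exact: subset_closure].
Qed.

(** For a real smooth [p >= 0], duality turns the integral of [p * Vt g] into that of
    [V p * g * weight], which is nonnegative in [R[i]]. Hence the real part of [Vt g] has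
    nonnegative integrals against all such [p], and the imaginary part has zero integrals. *)
Lemma dual_ge0 (R : realType) (k1 k2 : R) (V Vt : (R -> R[i]) -> R -> R[i])
    (g : R -> R[i]) :
  0 < k1 -> 0 < k2 ->
  intertwining_operator k1 k2 V -> dual_operator k1 k2 V Vt ->
  test_function g -> (forall x, 0 <= g x) -> forall y, 0 <= Vt g y.
Proof.
move=> k10 k20 hV hVt tg g0 y.
have th := dual_test hVt tg.
have [L hL] := test_function_bounded th.
have [sh _] := th; have /smoothE[sr si] := sh.
have int_ge0 p : rsmooth p -> (forall x, 0 <= p x) ->
    0 <= \int[lebesgue_measure]_x (p x * Ref (Vt g) x) /\
    \int[lebesgue_measure]_x (p x * Imf (Vt g) x) = 0.
  move=> sp p0; pose f x := (p x)%:C.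
  have sf : smooth f by apply/smoothE; split=> //; exact: rsmooth_cst.
  have f0 x : 0 <= f x by rewrite /f -[0]/(0%:C) lecR.
  have : 0 <= cintegral (fun y => f y * Vt g y).
    rewrite -(dual_integral hVt sf tg); apply: cintegral_ge0 => x.
    rewrite mulr_ge0//; last by rewrite -[0]/(0%:C) lecR mulr_ge0// powR_ge0.
    by rewrite mulr_ge0//; exact: (intertwining_ge0 k10 k20 hV sf).
  rewrite lecE /= => /andP[/eqP Im0 Re0]; split.
    move: Re0; congr (0 <= _); apply: eq_Rintegral => x _.
    by rewrite /f /Ref; case: (Vt g x) => [a b] /=; rewrite mul0r subr0.
  rewrite -[RHS]Im0; apply: eq_Rintegral => x _.
  by rewrite /f /Imf; case: (Vt g x) => [a b] /=; rewrite mul0r addr0.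
have LR x : Ref (Vt g) x != 0 -> `|x| <= L.
  by move=> h; apply: hL; apply: contra h => /eqP hx; rewrite /Ref hx.
have LI x : Imf (Vt g) x != 0 -> `|x| <= L.
  by move=> h; apply: hL; apply: contra h => /eqP hx; rewrite /Imf hx.
rewrite lecE /=; apply/andP; split; last first.
  by apply: (rsmooth_ge0_of_integral sr LR) => p sp /(int_ge0 _ sp)[].
rewrite eq_le; apply/andP; split; last first.
  by apply: (rsmooth_ge0_of_integral si LI) => p sp /(int_ge0 _ sp)[_ ->].
(* As its integrals against [p] vanish, the imaginary part and its opposite both satisfy the
   criterion. *)
have sN : rsmooth (fun x => - Imf (Vt g) x).
  have := rsmooth_lin (- 1) 0 si si; congr rsmooth; apply/funext => t.
  by rewrite mul0r addr0 mulN1r.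
rewrite -oppr_ge0; apply: (rsmooth_ge0_of_integral sN).
  by move=> x; rewrite oppr_eq0; exact: LI.
move=> p sp /(int_ge0 _ sp)[_ Ip].
have sup x : p x * Imf (Vt g) x != 0 -> `|x| <= L.
  by move=> h; apply: LI; apply: contraNneq h => ->; rewrite mulr0.
rewrite (@Rintegral_support _ _ L); last first.
  by move=> x; rewrite mulrN oppr_eq0; exact: sup.
under eq_Rintegral do rewrite mulrN -mulN1r.
rewrite RintegralZl//; first by rewrite -Rintegral_support// Ip mulr0.
apply: continuous_compact_integrable; first exact: segment_compact.
apply: continuous_subspaceT.
exact: (rsmooth_continuous (n := 0%N) (rsmoothM sp si)).
Qed.

(** * The kernel *)

(** On the compact interval [[a, b]] the continuous function [g] has a positive minimum. *)
Lemma Rintegral_gt0 (R : realType) (D : set R) (g : R -> R) (a b : R) :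
  measurable D -> lebesgue_measure.-integrable D (EFin \o g) ->
  `[a, b] `<=` D -> a < b -> (forall x, D x -> 0 < g x) ->
  {in D, continuous g} ->
  0 < \int[lebesgue_measure]_(x in D) g x.
Proof.
move=> mD ig abD ab g0 cg.
have [|c cab cmin] := @EVT_min R g a b (ltW ab).
  apply: continuous_in_subspaceT => x; rewrite inE => xab; apply: cg.
  by rewrite inE; exact: abD.
have gc : 0 < g c by apply: g0; apply: abD.
apply: (@lt_le_trans _ _ (g c * (b - a))); first by rewrite mulr_gt0// subr_gt0.
apply: Rintegral_ge_itv => //; first exact: ltW.
  exact: ltW.
by move=> x /g0/ltW.
Qed.

(** The compact intervals [[u n, v n]] exhaust [D]. On each, the integral is
    [G (v n) - G (u n) <= 2 M] by the fundamental theorem of calculus, and monotone convergence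
    passes this bound to [D]. *)
Lemma integrable_of_bounded_primitive (R : realType) (D : set R)
    (u v : nat -> R) (g G : R -> R) (M : R) :
  open D -> D = \bigcup_n `[u n, v n]%classic ->
  {homo u : m n / (m <= n)%N >-> n <= m} ->
  {homo v : m n / (m <= n)%N >-> m <= n} ->
  (forall n, u n < v n) ->
  (forall x, D x -> 0 <= g x) ->
  {in D, continuous g} ->
  (forall x, D x -> is_derive x 1 G (g x)) ->
  (forall x, D x -> `|G x| <= M) ->
  lebesgue_measure.-integrable D (EFin \o g).
Proof.
move=> oD DE hu hv uv g0 cg dG GM.
have mD : measurable D by exact: open_measurable.
have mg : measurable_fun D g by exact: open_continuous_measurable_fun.
apply/integrableP; split; first exact/measurable_EFinP.
pose F n : set R := `[u n, v n]%classic.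
have FD n : F n `<=` D by rewrite DE => x Fx; exists n.
have -> : (\int[lebesgue_measure]_(x in D) `|(EFin \o g) x|
    = \int[lebesgue_measure]_(x in \bigcup_n F n) (g x)%:E)%E.
  rewrite -/F -DE; apply: eq_integral => x; rewrite inE => xD.
  by rewrite /= ger0_norm// g0.
have ndF : nondecreasing_seq F.
  move=> m n mn; apply/subsetPset => x; rewrite /F /= !in_itv /= => /andP[p q].
  by rewrite (le_trans (hu _ _ mn))//= (le_trans q)// hv.
have cvgF : (\int[lebesgue_measure]_(x in F i) (g x)%:E @[i --> \oo] -->
     \int[lebesgue_measure]_(x in \bigcup_i F i) (g x)%:E)%E.
  apply: ge0_nondecreasing_set_cvg_integral => [//|i|i|i x Fx].
  - exact: measurable_itv.
  - by apply/measurable_EFinP; apply: measurable_funS mg => //; exact: FD.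
  - by rewrite lee_fin; apply: g0; exact: FD Fx.
apply: (@le_lt_trans _ _ ((M + M)%:E)); last exact: ltry.
rewrite -(cvg_lim _ cvgF)//; apply: lime_le; first exact: cvgP cvgF.
apply: nearW => n.
have ends : D (u n) /\ D (v n).
  by split; apply: (FD n); rewrite /F /= in_itv /= lexx ltW.
have cG x : D x -> {for x, continuous G}.
  by move=> /dG [dGx _]; exact: derivable1_continuous.
rewrite (@continuous_FTC2 R g G (u n) (v n))//.
- rewrite -EFinB lee_fin.
  have := GM _ ends.1; have := GM _ ends.2; rewrite !ler_norml.
  by move=> /andP[? ?] /andP[? ?]; lra.
- apply: continuous_in_subspaceT => x; rewrite inE => xF; apply: cg.
  by rewrite inE; exact: (FD n).
- split.
  + move=> x /subset_itv_oo_cc xF; by have [] := dG x (FD n x xF).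
  + by apply: cvg_at_right_filter; apply: cG; exact: ends.1.
  + by apply: cvg_at_left_filter; apply: cG; exact: ends.2.
- move=> x /subset_itv_oo_cc xF.
  by rewrite derive1E; have [_ ->] := dG x (FD n x xF).
Qed.

(** A power is monotone, in a direction given by the sign of [e]; the sum of both end values covers
    the two cases at once. *)
Lemma powR_le_ends (R : realType) (p p0 p1 e : R) :
  0 < p0 -> p0 <= p -> p <= p1 -> p `^ e <= p0 `^ e + p1 `^ e.
Proof.
move=> p00 p0p pp1.
have pp : 0 < p by exact: lt_le_trans p0p.
have p10 : 0 < p1 by exact: lt_le_trans pp1.
have [e0|e0] := leP 0 e.
  rewrite ler_wpDl ?powR_ge0//.
  by apply: ge0_ler_powR => //; rewrite nnegrE ltW.
rewrite ler_wpDr ?powR_ge0// -(opprK e) !(powRN _ (- e)).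
rewrite lef_pV2 ?posrE ?powR_gt0//.
have e1 : 0 <= - e by rewrite oppr_ge0 ltW.
by apply: ge0_ler_powR => //; rewrite nnegrE ltW.
Qed.

(** The inequality [1 + v <= expR v] at [v = t / (s + 1)], raised to the power [s + 1]. *)
Lemma powR_expR_bound (R : realType) (s t : R) : 0 < s -> 0 <= t ->
  (1 + t) `^ (s + 1) <= (s + 1) `^ (s + 1) * expR t.
Proof.
move=> s0 t0; have s1 : 0 < s + 1 by lra.
have h : 1 + t <= (s + 1) * expR (t / (s + 1)).
  apply: (@le_trans _ _ ((s + 1) * (1 + t / (s + 1)))).
    by rewrite mulrDr mulr1 mulrCA divff ?gt_eqF// mulr1; lra.
  by rewrite ler_pM2l// expR_ge1Dx.
have e0 : 0 <= expR (t / (s + 1)) by exact: expR_ge0.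
apply: (@le_trans _ _ (((s + 1) * expR (t / (s + 1))) `^ (s + 1))).
  apply: ge0_ler_powR => //; rewrite ?nnegrE; first exact: ltW.
    by lra.
  by rewrite mulr_ge0// ltW.
rewrite powRM//; last exact: ltW.
by rewrite -expRM divfK// gt_eqF.
Qed.

Lemma integrable_itvoo_of_primitive (R : realType) (a b : R) (g G : R -> R)
    (M : R) : a < b ->
  (forall x : R, a < x < b -> 0 <= g x) ->
  (forall x : R, a < x < b -> {for x, continuous g}) ->
  (forall x : R, a < x < b -> is_derive x 1 G (g x)) ->
  (forall x : R, a < x < b -> `|G x| <= M) ->
  lebesgue_measure.-integrable `]a, b[%classic (EFin \o g).
Proof.
move=> ab g0 cg dG GM.
have ba : 0 < b - a by rewrite subr_gt0.
(* The shift by 3 gives [e n <= (b - a) / 3], hence [a + e n < b - e n] already for [n = 0]. *)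
pose e (n : nat) : R := (b - a) / n.+3%:R.
have e0 n : 0 < e n by rewrite divr_gt0.
have e3 n : e n <= (b - a) / 3.
  by rewrite /e ler_pM2l// lef_pV2 ?posrE// ler_nat.
have eh : {homo e : m n / (m <= n)%N >-> n <= m}.
  by move=> m n mn; rewrite /e ler_pM2l// lef_pV2 ?posrE// ler_nat !ltnS.
apply: (@integrable_of_bounded_primitive _ _ (fun n => a + e n)
  (fun n => b - e n) g G M) => //.
- apply/seteqP; split=> x.
    rewrite /= in_itv/= => /andP[ax xb].
    have [n1 n1P] := nat_above ((b - a) / (x - a)).
    have [n2 n2P] := nat_above ((b - a) / (b - x)).
    exists (n1 + n2)%N => //=; rewrite in_itv/=.
    have n12 : (n1 + n2).+3%:R = n1%:R + n2%:R + 3 :> R.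
      by rewrite -addn3 !natrD.
    have N1 : 0 <= n1%:R :> R by [].
    have N2 : 0 <= n2%:R :> R by [].
    rewrite ler_pdivrMr ?subr_gt0// in n1P.
    rewrite ler_pdivrMr ?subr_gt0// in n2P.
    apply/andP; split.
      rewrite -lerBrDl /e ler_pdivrMr// n12 mulrC; nra.
    rewrite lerBrDr -lerBrDl /e ler_pdivrMr// n12 mulrC; nra.
  move=> [n _ /=]; rewrite !in_itv/= => /andP[h1 h2].
  by have := e0 n; move=> h; apply/andP; split; lra.
- by move=> m n mn; rewrite lerD2l eh.
- by move=> m n mn; rewrite lerD2l lerN2 eh.
- by move=> n; have := e3 n; lra.
- by move=> x; rewrite inE; exact: cg.
Qed.

(** * Finiteness and positivity of the Gamma integral *)

(** With [q = t / (1 + t)], which has values in []0, 1]] and derivative [(1 + t)^-2], the integrand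
    has the bounded primitive [q^s / s]. It dominates the Gamma integrand up to a constant. *)
Lemma integrable_gammaD (R : realType) (s : R) : 0 < s ->
  lebesgue_measure.-integrable `]0, +oo[%classic
    (EFin \o (fun t : R => (t / (1 + t)) `^ (s - 1) * ((1 + t) ^+ 2)^-1)).
Proof.
move=> s0.
pose q (t : R) := t / (1 + t).
have dq (t : R) : 0 < t -> is_derive t 1 q (((1 + t) ^+ 2)^-1).
  move=> t0; have t1 : 1 + t != 0 by rewrite gt_eqF//; lra.
  have d1 : is_derive t 1 (fun t => 1 + t) 1.
    have := is_derive_fctD (is_derive_cst (1 : R^o) t 1) (is_derive_id t 1).
    by rewrite add0r.
  have d2 := is_deriveV t1 d1.
  apply: is_derive_fct (is_derive_fctM (is_derive_id t 1) d2).
  by rewrite /GRing.scale /=; field.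
have q01 (t : R) : 0 < t -> 0 < q t /\ q t <= 1.
  move=> t0; split; first by rewrite divr_gt0//; lra.
  by rewrite ler_pdivrMr; lra.
have dpow (t e : R) : 0 < t ->
    is_derive t 1 (fun t => q t `^ e) (e * q t `^ (e - 1) * ((1 + t) ^+ 2)^-1).
  move=> t0; have [q0 _] := q01 _ t0.
  have := is_derive1_comp (is_derive1_powR e q0) (dq _ t0).
  exact.
apply: (@integrable_of_bounded_primitive _ _ (fun n => n.+2%:R^-1)
  (fun n => n.+1%:R) _ (fun t => s^-1 * q t `^ s) s^-1) => //.
- apply/seteqP; split=> x.
    rewrite /= in_itv/= andbT => x0.
    have [n1 n1P] := nat_above x.
    have [n2 n2P] := nat_above x^-1.
    exists (n1 + n2)%N => //=; rewrite in_itv/=; apply/andP; split.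
      rewrite -[leRHS]invrK lef_pV2 ?posrE ?invr_gt0//.
      apply: le_trans n2P _; rewrite ler_nat.
      by do 2 apply: leqW; exact: leq_addl.
    by apply: le_trans n1P _; rewrite ler_nat; apply: leqW; exact: leq_addr.
  move=> [n _ /=]; rewrite !in_itv/= andbT => /andP[h1 h2].
  by apply: lt_le_trans h1; rewrite invr_gt0.
- by move=> m n mn; rewrite lef_pV2 ?posrE// ler_nat !ltnS.
- by move=> m n mn; rewrite ler_nat !ltnS.
- move=> n; apply: (@lt_le_trans _ _ 1); last by rewrite ler1n.
  by rewrite invf_lt1 ?ltr1n.
- by move=> x _; rewrite mulr_ge0 ?powR_ge0// invr_ge0 sqr_ge0.
- move=> x; rewrite inE /= in_itv/= andbT => x0.
  apply: cvgM.
    by apply: (derivable1_continuous (f := fun t => q t `^ (s - 1)));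
      have [] := dpow _ (s - 1) x0.
  apply: cvgV; first by rewrite gt_eqF// exprn_gt0//; lra.
  apply: (@continuous_comp _ _ _ (fun t : R => 1 + t) (fun t => t ^+ 2)).
    by apply: cvgD; [exact: cvg_cst|exact: cvg_id].
  exact: exprn_continuous.
- move=> x; rewrite /= in_itv/= andbT => x0.
  apply: is_derive_fct (is_derive_fctZ s^-1 (dpow _ s x0)).
  by rewrite !mulrA mulVf ?gt_eqF// mul1r.
- move=> x; rewrite /= in_itv/= andbT => x0; have [q0 q1] := q01 _ x0.
  rewrite ger0_norm; last by rewrite mulr_ge0 ?powR_ge0// invr_ge0 ltW.
  rewrite ler_piMr ?invr_ge0 ?(ltW s0)//.
  have -> : 1 = 1 `^ s :> R by rewrite powR1.
  by apply: ge0_ler_powR; rewrite ?nnegrE ?(ltW s0) ?(ltW q0).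
Qed.

(** Integrability has to be proved, since a real integral takes the value 0 when the extended one is
    infinite. *)
Lemma Gamma_gt0 (R : realType) (s : R) : 0 < s -> 0 < Gamma s.
Proof.
move=> s0; rewrite /Gamma.
pose f (t : R) := t `^ (s - 1) * expR (- t).
have cf : {in (`]0, +oo[%classic : set R), continuous f}.
  move=> x; rewrite inE /= in_itv/= andbT => x0.
  apply: cvgM.
    apply: (derivable1_continuous (f := fun t => t `^ (s - 1))).
    by have [] := is_derive1_powR (s - 1) x0.
  apply: continuous_comp; last exact: continuous_expR.
  exact: opp_continuous.
have oD : open (`]0, +oo[%classic : set R) by [].
have mf : measurable_fun (`]0, +oo[%classic : set R) f.
  exact: open_continuous_measurable_fun.
apply: (@Rintegral_gt0 _ _ f 1 2) => //.
- have /(integrableZl _ ((s + 1) `^ (s + 1))) := integrable_gammaD s0.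
  move=> /(_ (measurable_itv _)).
  apply: le_integrable => //; first exact/measurable_EFinP.
  move=> t; rewrite /= in_itv/= andbT => t0.
  have t1 : 0 < 1 + t by lra.
  have C0 := powR_ge0 (s + 1) (s + 1).
  have h0 := powR_gt0 (s + 1) t1.
  rewrite lee_fin !ger0_norm ?mulr_ge0 ?powR_ge0 ?expR_ge0 ?invr_ge0 ?sqr_ge0//.
  have t1' : 0 <= (1 + t)^-1 by rewrite invr_ge0 ltW.
  rewrite (powRM _ (ltW t0) t1') /f -mulrA mulrCA.
  apply: ler_wpM2l; first exact: powR_ge0.
  (* The majorant is thus [t^(s - 1) / (1 + t)^(s + 1)], and [powR_expR_bound] compares it with
     [t^(s - 1) expR (- t)]. *)
  have -> : (1 + t)^-1 `^ (s - 1) * ((1 + t) ^+ 2)^-1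
      = ((1 + t) `^ (s + 1))^-1.
    rewrite -(powR_inv1 (ltW t1)) -powRrM mulN1r -(powR_invn _ (ltW t1)).
    rewrite -powRD; last first.
      by rewrite (gt_eqF t1) implybT.
    by rewrite -powRN; congr (_ `^ _); lra.
  rewrite expRN ler_pdivlMr// mulrC ler_pdivrMr ?expR_gt0//.
  exact: powR_expR_bound (ltW t0).
- by move=> x; rewrite /= !in_itv/= => /andP[? _]; rewrite andbT; lra.
- by rewrite ltr1n.
- move=> x; rewrite /= in_itv/= andbT => x0.
  by rewrite mulr_gt0 ?powR_gt0 ?expR_gt0.
Qed.

(** * Hyperbolic functions *)

Lemma is_derive_cosh (R : realType) (x : R) : is_derive x 1 cosh (sinh x).
Proof.
have dN := is_derive1_comp (is_derive_expR (- x))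
  (is_derive_fctN (is_derive_id x 1)).
have := is_derive_fctZ 2^-1 (is_derive_fctD (is_derive_expR x) dN).
rewrite (_ : (fun t => _) = cosh); last first.
  by apply/funext => t; rewrite /cosh mulrC.
by apply: is_derive_fct; rewrite /sinh mulrC mulrN1.
Qed.

Lemma continuous_cosh (R : realType) : continuous (@cosh R).
Proof.
by move=> x; apply: derivable1_continuous; have [] := is_derive_cosh x.
Qed.

Lemma continuous_sinh (R : realType) : continuous (@sinh R).
Proof.
move=> x; apply: cvgM; last exact: cvg_cst.
apply: cvgB; first exact: continuous_expR.
apply: continuous_comp; [exact: opp_continuous|exact: continuous_expR].
Qed.

Lemma coshN (R : realType) (x : R) : cosh (- x) = cosh x.
Proof. by rewrite /cosh opprK addrC. Qed.

Lemma cosh_norm (R : realType) (x : R) : cosh `|x| = cosh x.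
Proof. by have [x0|x0] := ger0P x; rewrite ?coshN. Qed.

Lemma cosh_gt0 (R : realType) (x : R) : 0 < cosh x.
Proof. by rewrite divr_gt0// addr_gt0 ?expR_gt0. Qed.

Lemma sinh_gt0 (R : realType) (x : R) : 0 < x -> 0 < sinh x.
Proof. by move=> x0; rewrite divr_gt0// subr_gt0 ltr_expR; lra. Qed.

(** Factorization: [cosh y - cosh x = (e^y - e^x) (1 - e^(- (x + y))) / 2]. *)
Lemma cosh_lt (R : realType) (x y : R) : 0 <= x -> x < y -> cosh x < cosh y.
Proof.
move=> x0 xy; rewrite -subr_gt0.
rewrite (_ : _ - _ = (expR y - expR x) * (1 - expR (- (x + y))) / 2).
  rewrite divr_gt0// mulr_gt0// subr_gt0 ?ltr_expR// expR_lt1; lra.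
rewrite /cosh opprD !expRD; have := expRxMexpNx_1 x; have := expRxMexpNx_1 y.
move: (expR x) (expR y) (expR (- x)) (expR (- y)) => a b a' b' h1 h2.
rewrite (_ : (b - a) * (1 - a' * b') = b - a - a' * (b * b') + b' * (a * a')).
  by rewrite h1 h2; lra.
by ring.
Qed.

Lemma sinh_le (R : realType) (x y : R) : x <= y -> sinh x <= sinh y.
Proof.
move=> xy; rewrite /sinh ler_pM2r ?invr_gt0//.
by rewrite lerB// ler_expR// lerN2.
Qed.

Lemma expR_half_cosh (R : realType) (x : R) :
  expR (x / 2) * (2 * cosh (x / 2)) = expR x + 1.
Proof.
rewrite /cosh [2 * _]mulrC divfK// mulrDr -!expRD.
by rewrite subrr expR0; congr (expR _ + _); lra.
Qed.

(** * Bounds on the factor sigma *)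

(** For [x > 0] both factors of the first product are the larger ones, as [- y < x] and [z < x]. For
    [x < 0] the sign exchanges the products, and replacing [z] by [y] in the second leaves
    [e^(- y) + 1], which is at least [e^x + 1]. *)
Lemma kernel_sigma_gt0 (R : realType) (x y z : R) :
  `|y| < z -> z < `|x| -> 0 < kernel_sigma x y z.
Proof.
move=> yz zx; rewrite /kernel_sigma.
have y0 := normr_ge0 y.
have [x0|x0|x0] := ltgtP x 0; last by move: zx; rewrite x0 normr0; lra.
- rewrite ltr0_sg// mulN1r opprB subr_gt0 expR_half_cosh.
  rewrite (ltr0_norm x0) in zx.
  apply: (@le_lt_trans _ _ (expR (- (y / 2)) * (2 * cosh (y / 2)))).
    have := expR_half_cosh (- y); rewrite mulNr coshN => ->.
    rewrite lerD2r ler_expR; have := ler_norm y; lra.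
  rewrite ltr_pM2l ?expR_gt0// ltr_pM2l// -cosh_norm.
  apply: cosh_lt => //.
  by rewrite normrM [`|2^-1|]ger0_norm// ltr_pM2r ?invr_gt0.
- rewrite gtr0_sg// mul1r subr_gt0.
  rewrite (gtr0_norm x0) in zx.
  apply: (@le_lt_trans _ _ (expR (x / 2) * (2 * cosh (z / 2)))).
    apply: ler_wpM2r; first by rewrite mulr_ge0// ltW// cosh_gt0.
    rewrite ler_expR.
    by have := ler_norm (- y); rewrite normrN; lra.
  by rewrite ltr_pM2l ?expR_gt0// ltr_pM2l// cosh_lt//; lra.
Qed.

(** A bound free of [z]: the sum of the two products covers both signs of [x], with [cosh (z / 2)]
    replaced by the larger [cosh (x / 2)]. *)
Lemma kernel_sigma_le (R : realType) (x y z : R) :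
  `|y| < z -> z < `|x| ->
  kernel_sigma x y z <= expR (x / 2) * (2 * cosh (x / 2))
    + expR (- (y / 2)) * (2 * cosh (x / 2)).
Proof.
move=> yz zx; rewrite /kernel_sigma; have y0 := normr_ge0 y.
have cz : cosh (z / 2) <= cosh (x / 2).
  rewrite -[leRHS]cosh_norm; apply/ltW/cosh_lt; first by lra.
  by rewrite normrM [`|2^-1|]ger0_norm// ltr_pM2r ?invr_gt0.
have := cosh_gt0 (z / 2); have := cosh_gt0 (x / 2).
have : expR (- (y / 2)) * cosh (z / 2) <= expR (- (y / 2)) * cosh (x / 2).
  by rewrite ler_pM2l ?expR_gt0.
have := expR_gt0 (x / 2); have := expR_gt0 (- (y / 2)).
set A := expR (- (y / 2)); set B := expR (x / 2).
set C := cosh (x / 2); set D := cosh (z / 2) => A0 B0 h C0 D0.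
have BC : 0 < B * C by rewrite mulr_gt0.
have AD : 0 < A * D by rewrite mulr_gt0.
have AC : 0 < A * C by rewrite mulr_gt0.
case: sgrP => _; rewrite ?mul0r ?mul1r ?mulN1r; nra.
Qed.

(** * Integrability of the kernel integrand and positivity of the kernel *)

Definition kernel_integrand (R : realType) (k1 k2 x y z : R) : R :=
  kernel_sigma x y z
     * (cosh (z / 2) - cosh (y / 2)) `^ (k1 - 1)
     * (cosh x - cosh z) `^ (k2 - 1)
     * sinh (z / 2).

Section KernelIntegrand.
Context {R : realType}.
Variables (k1 k2 x y : R).
Hypotheses (k10 : 0 < k1) (k20 : 0 < k2) (yx : `|y| < `|x|).

Let a : R := `|y|.
Let b : R := `|x|.
(** The bases of the two powers: [P] vanishes at [a] and [Q] at [b], so that each power can be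
    singular at one end only. *)
Let P z := cosh (z / 2) - cosh (y / 2).
Let Q z := cosh x - cosh z.

Let dP (z : R) : is_derive z 1 P (sinh (z / 2) / 2).
Proof.
have dh : is_derive z 1 (fun z => z / 2) (2^-1 : R).
  have := is_derive_fctZ 2^-1 (is_derive_id z 1).
  by rewrite mulr1; congr is_derive; apply/funext => t; rewrite mulrC.
have := is_derive_fctD (is_derive1_comp (f := cosh)
    (g := fun z => z / 2) (is_derive_cosh (z / 2)) dh)
  (is_derive_cst (- cosh (y / 2) : R^o) z 1).
by rewrite addr0.
Qed.

Let dQ (z : R) : is_derive z 1 Q (- sinh z).
Proof.
have := is_derive_fctD (is_derive_cst (cosh x : R^o) z 1)
  (is_derive_fctN (is_derive_cosh z)).
by rewrite add0r.
Qed.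

Let P_lt z1 z2 : a <= z1 -> z1 < z2 -> P z1 < P z2.
Proof.
move=> az zz; rewrite ltrD2r cosh_lt//; last by rewrite ltr_pM2r ?invr_gt0.
by rewrite divr_ge0//; exact: le_trans (normr_ge0 y) az.
Qed.

Let Q_lt z1 z2 : a <= z1 -> z1 < z2 -> Q z2 < Q z1.
Proof.
move=> az zz; rewrite ltrD2l ltrN2 cosh_lt//.
exact: le_trans (normr_ge0 y) az.
Qed.

Let Pa : P a = 0.
Proof.
by rewrite /P -[cosh (y / 2)]cosh_norm normrM [`|2^-1|]ger0_norm// subrr.
Qed.

Let Qb : Q b = 0.
Proof. by rewrite /Q /b cosh_norm subrr. Qed.

Let P_gt0 z : a < z -> 0 < P z.
Proof. by move=> az; rewrite -Pa P_lt. Qed.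

Let Q_gt0 z : a <= z -> z < b -> 0 < Q z.
Proof. by move=> az zb; rewrite -Qb Q_lt. Qed.

Let a0 : 0 <= a. Proof. exact: normr_ge0. Qed.

Lemma kernel_integrand_gt0 (z : R) :
  a < z -> z < b -> 0 < kernel_integrand k1 k2 x y z.
Proof.
move=> az zb; have s0 := kernel_sigma_gt0 az zb.
have z0 : 0 < z / 2 by have := a0; lra.
have p0 := powR_gt0 (k1 - 1) (P_gt0 az).
have q0 := powR_gt0 (k2 - 1) (Q_gt0 (ltW az) zb).
exact: mulr_gt0 (mulr_gt0 (mulr_gt0 s0 p0) q0) (sinh_gt0 z0).
Qed.

Let cpowP (e z : R) : a < z -> {for z, continuous (fun z : R => P z `^ e)}.
Proof.
move=> az; apply: (derivable1_continuous (f := fun z => P z `^ e)).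
by have [] := is_derive1_comp (is_derive1_powR e (P_gt0 az)) (dP z).
Qed.

Let cpowQ (e z : R) :
  a < z -> z < b -> {for z, continuous (fun z : R => Q z `^ e)}.
Proof.
move=> az zb; apply: (derivable1_continuous (f := fun z => Q z `^ e)).
by have [] := is_derive1_comp (is_derive1_powR e (Q_gt0 (ltW az) zb)) (dQ z).
Qed.

Let chalf (f : R -> R) (z : R) :
  continuous f -> {for z, continuous (fun z : R => f (z / 2))}.
Proof.
move=> cf; apply: (@continuous_comp _ _ _ (fun z : R => z / 2) f).
  exact: mulrr_continuous.
exact: cf.
Qed.

Lemma kernel_integrand_continuous (z : R) : a < z -> z < b ->
  {for z, continuous (kernel_integrand k1 k2 x y)}.
Proof.
move=> az zb.
apply: cvgM; last by apply: (chalf (f := sinh)); exact: continuous_sinh.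
apply: cvgM; last exact: cpowQ.
apply: cvgM; last exact: cpowP.
apply: cvgM; first exact: cvg_cst.
apply: cvgB; first exact: cvg_cst.
apply: cvgM; first exact: cvg_cst.
apply: cvgM; first exact: cvg_cst.
by apply: (chalf (f := cosh)); exact: continuous_cosh.
Qed.

(** Left of [c] the power of [Q] is bounded, right of [c] that of [P]. The integrand is thus below a
    sum of two terms, each with a single power and an explicit primitive; [sinh (z / 2) <= sinh z]
    brings in the derivative of [Q]. *)
Lemma kernel_integrand_le (S c z : R) : a < z -> z < b -> a < c -> c < b ->
  (forall z, a < z -> z < b -> kernel_sigma x y z <= S) ->
  kernel_integrand k1 k2 x y z <=
    S * (Q c `^ (k2 - 1) + Q a `^ (k2 - 1)) * (P z `^ (k1 - 1) * sinh (z / 2))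
    + S * (P c `^ (k1 - 1) + P b `^ (k1 - 1)) * (Q z `^ (k2 - 1) * sinh z).
Proof.
move=> az zb ac cb SP.
have s0 := kernel_sigma_gt0 az zb.
have sS := SP z az zb.
have z0 := le_lt_trans a0 az.
have sh0 : 0 < sinh (z / 2) by rewrite sinh_gt0//; lra.
have sh : sinh (z / 2) <= sinh z by rewrite sinh_le//; lra.
rewrite /kernel_integrand -/(P z) -/(Q z).
have p0 := powR_ge0 (P z) (k1 - 1); have q0 := powR_ge0 (Q z) (k2 - 1).
have pc := powR_ge0 (P c) (k1 - 1); have qc := powR_ge0 (Q c) (k2 - 1).
have pb := powR_ge0 (P b) (k1 - 1); have qa := powR_ge0 (Q a) (k2 - 1).
have zab : Q z `^ (k2 - 1) <= Q c `^ (k2 - 1) + Q a `^ (k2 - 1) \/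
    P z `^ (k1 - 1) <= P c `^ (k1 - 1) + P b `^ (k1 - 1).
  have [zc|cz] := ltP z c; [left|right]; apply: powR_le_ends.
  - exact/Q_gt0/cb/ltW.
  - by apply/ltW/Q_lt/zc/ltW.
  - by apply/ltW/Q_lt/az.
  - exact: P_gt0.
  - move: cz; rewrite le_eqVlt => /predU1P[->|cz]; first exact: lexx.
    by apply/ltW/P_lt/cz/ltW.
  - by apply/ltW/P_lt/zb/ltW.
move: p0 q0 pc qc pb qa zab.
move: (P z `^ _) (Q z `^ _) (P c `^ _) (Q c `^ _) (P b `^ _) (Q a `^ _).
move: (kernel_sigma x y z) (sinh (z / 2)) (sinh z) s0 sS sh0 sh.
move=> s h1 h2 s0 sS sh0 sh p q p1 q1 p2 q2 p0 q0 pc qc pb qa zab.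
have qh0 := mulr_ge0 q0 (ltW sh0); have ph0 := mulr_ge0 p0 (ltW sh0).
rewrite -!mulrA -mulrDr; apply: ler_pM (ltW s0) (mulr_ge0 p0 qh0) sS _.
case: zab => [qz|pz].
  apply: ler_wpDr.
    exact: mulr_ge0 (addr_ge0 pc pb) (mulr_ge0 q0 (le_trans (ltW sh0) sh)).
  by rewrite mulrCA; exact: ler_wpM2r ph0 _ _ qz.
apply: ler_wpDl; first exact: mulr_ge0 (addr_ge0 qc qa) ph0.
exact: ler_pM p0 qh0 pz (ler_wpM2l q0 sh).
Qed.

(** The primitive [(2 A / k1) P^k1 - (B / k2) Q^k2] is bounded on the interval because [k1] and [k2]
    are positive; the 2 offsets the half in the derivative of [P]. *)
Lemma integrable_kernel_majorant (A B : R) : 0 <= A -> 0 <= B ->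
  lebesgue_measure.-integrable `]a, b[%classic
    (EFin \o (fun z => A * (P z `^ (k1 - 1) * sinh (z / 2))
      + B * (Q z `^ (k2 - 1) * sinh z))).
Proof.
move=> A0 B0.
have k1n : k1 != 0 by rewrite gt_eqF.
have k2n : k2 != 0 by rewrite gt_eqF.
have := @integrable_itvoo_of_primitive R a b
  (fun z => A * (P z `^ (k1 - 1) * sinh (z / 2))
      + B * (Q z `^ (k2 - 1) * sinh z))
  (fun z => A * 2 / k1 * P z `^ k1 + - (B / k2) * Q z `^ k2)
  (A * 2 / k1 * P b `^ k1 + B / k2 * Q a `^ k2) yx.
apply; move=> z /andP[az zb].
- have z1 := le_lt_trans a0 az.
  have z0 : 0 < z / 2 by lra.
  have p0 := powR_ge0 (P z) (k1 - 1); have q0 := powR_ge0 (Q z) (k2 - 1).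
  exact: addr_ge0 (mulr_ge0 A0 (mulr_ge0 p0 (ltW (sinh_gt0 z0))))
    (mulr_ge0 B0 (mulr_ge0 q0 (ltW (sinh_gt0 z1)))).
- apply: cvgD.
    apply: cvgM; first exact: cvg_cst.
    apply: cvgM; first exact: cpowP.
    by apply: (chalf (f := sinh)); exact: continuous_sinh.
  apply: cvgM; first exact: cvg_cst.
  apply: cvgM; first exact: cpowQ.
  exact: continuous_sinh.
- have d1 := is_derive1_comp (is_derive1_powR k1 (P_gt0 az)) (dP z).
  have d2 := is_derive1_comp (is_derive1_powR k2 (Q_gt0 (ltW az) zb)) (dQ z).
  apply: is_derive_fct (is_derive_fctD (is_derive_fctZ (A * 2 / k1) d1)
    (is_derive_fctZ (- (B / k2)) d2)).
  move: (P z `^ _) (Q z `^ _) (sinh (z / 2)) (sinh z) => p q h1 h2.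
  by field; rewrite k1n k2n.
- have Ak : 0 <= A * 2 / k1 by rewrite divr_ge0 ?mulr_ge0 ?(ltW k10).
  have Bk : 0 <= B / k2 by rewrite divr_ge0 ?(ltW k20).
  have Pz := ltW (P_gt0 az); have Qz := ltW (Q_gt0 (ltW az) zb).
  have Pzb : P z `^ k1 <= P b `^ k1.
    have Pzb := ltW (P_lt (ltW az) zb).
    have Pb0 := le_trans Pz Pzb.
    by apply: ge0_ler_powR (ltW k10) _ _ _ _ Pzb; rewrite nnegrE.
  have Qza : Q z `^ k2 <= Q a `^ k2.
    have Qza := ltW (Q_lt (lexx a) az).
    have Qa0 := le_trans Qz Qza.
    by apply: ge0_ler_powR (ltW k20) _ _ _ _ Qza; rewrite nnegrE.
  move: (powR_ge0 (P z) k1) (powR_ge0 (Q z) k2) Pzb Qza.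
  move: (P z `^ k1) (Q z `^ k2) (P b `^ k1) (Q a `^ k2).
  move=> p q p1 q1 p0 q0 pp qq.
  have Ap := mulr_ge0 Ak p0; have Bq := mulr_ge0 Bk q0.
  apply: le_trans (ler_normD _ _) _; rewrite mulNr normrN.
  by rewrite (ger0_norm Ap) (ger0_norm Bq) lerD// ler_wpM2l.
Qed.

Lemma integrable_kernel_integrand :
  lebesgue_measure.-integrable `]a, b[%classic
    (EFin \o kernel_integrand k1 k2 x y).
Proof.
pose c := (a + b) / 2.
have ab : a < b by [].
have ac : a < c by rewrite /c; lra.
have cb : c < b by rewrite /c; lra.
pose S := expR (x / 2) * (2 * cosh (x / 2))
  + expR (- (y / 2)) * (2 * cosh (x / 2)).
have SP z : a < z -> z < b -> kernel_sigma x y z <= S by exact: kernel_sigma_le.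
have S0 : 0 <= S.
  have c0 : 0 <= 2 * cosh (x / 2) by rewrite mulr_ge0// ltW// cosh_gt0.
  exact: addr_ge0 (mulr_ge0 (expR_ge0 _) c0) (mulr_ge0 (expR_ge0 _) c0).
pose A := S * (Q c `^ (k2 - 1) + Q a `^ (k2 - 1)).
pose B := S * (P c `^ (k1 - 1) + P b `^ (k1 - 1)).
have A0 : 0 <= A by rewrite mulr_ge0// addr_ge0 ?powR_ge0.
have B0 : 0 <= B by rewrite mulr_ge0// addr_ge0 ?powR_ge0.
apply: le_integrable (integrable_kernel_majorant A0 B0) => //.
  apply/measurable_EFinP; apply: open_continuous_measurable_fun => //.
  move=> z; rewrite inE /= in_itv/= => /andP[az zb].
  exact: kernel_integrand_continuous.
move=> z; rewrite /= in_itv/= => /andP[az zb]; rewrite lee_fin.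
rewrite ger0_norm; last exact/ltW/kernel_integrand_gt0.
apply: le_trans (ler_norm _).
exact: kernel_integrand_le az zb ac cb SP.
Qed.

Lemma kernel_integral_gt0 :
  0 < \int[lebesgue_measure]_(z in `](`|y|), (`|x|)[)
    kernel_integrand k1 k2 x y z.
Proof.
have ab : a < b := yx.
have ba3 : 0 < (b - a) / 3 by rewrite divr_gt0// subr_gt0.
(* The middle third of the open interval serves as compact subinterval. *)
apply: (@Rintegral_gt0 _ _ _ (a + (b - a) / 3) (b - (b - a) / 3)) => //.
- exact: integrable_kernel_integrand.
- move=> z; rewrite /= !in_itv/= -/a -/b => /andP[? ?].
  by apply/andP; split; lra.
- by lra.
- by move=> z; rewrite /= in_itv/= => /andP[? ?]; exact: kernel_integrand_gt0.
- move=> z; rewrite inE /= in_itv/= => /andP[? ?].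
  exact: kernel_integrand_continuous.
Qed.

Lemma kernelK_gt0 : 0 < kernelK k1 k2 x y.
Proof.
have x0 : x != 0 by rewrite -normr_gt0; exact: le_lt_trans yx.
have sinh_neq0 (t : R) : t != 0 -> `|2 * sinh t| > 0.
  move=> t0; rewrite normr_gt0 mulf_neq0// mulf_neq0// subr_eq0.
  by apply: contra t0 => /eqP /expR_inj tN; apply/eqP; lra.
have k12 : 0 < k1 + k2 + 1 / 2 by rewrite !addr_gt0.
have weight_gt0 : 0 < weight k1 k2 x.
  apply: mulr_gt0; apply: powR_gt0; apply: sinh_neq0 => //.
  by rewrite mulf_neq0.
have const_gt0 : 0 < kernel_const k1 k2.
  apply: divr_gt0; first by apply: mulr_gt0; [exact: powR_gt0|exact: Gamma_gt0].
  apply: mulr_gt0 (Gamma_gt0 k20); apply: mulr_gt0 (Gamma_gt0 k10).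
  by rewrite sqrtr_gt0 pi_gt0.
apply: mulr_gt0 kernel_integral_gt0; apply: mulr_gt0; last by rewrite invr_gt0.
exact: divr_gt0.
Qed.

End KernelIntegrand.

Theorem corollary3p1 (R : realType) (k1 k2 : R) (hk1 : 0 < k1) (hk2 : 0 < k2) :
  (forall x y : R, `|y| < `|x| -> 0 < kernelK k1 k2 x y)
  /\ (forall V : (R -> R[i]) -> (R -> R[i]),
        intertwining_operator k1 k2 V ->
        (forall f : R -> R[i], smooth f -> (forall x : R, 0 <= f x) ->
           forall x : R, 0 <= V f x)
        /\ (forall Vt : (R -> R[i]) -> (R -> R[i]),
              dual_operator k1 k2 V Vt ->
              forall g : R -> R[i], test_function g -> (forall x : R, 0 <= g x) ->
                forall y : R, 0 <= Vt g y)).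
Proof.
split=> [x y yx|V hV]; first exact: kernelK_gt0.
split=> [f sf f0 x|Vt hVt g tg g0 y].
  exact: (intertwining_ge0 hk1 hk2 hV sf).
exact: (dual_ge0 hk1 hk2 hV hVt tg).
Qed.
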